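(* Let $d\ge1$, $T>0$ and $(H_0,\dots,H_d)\in(0,1)^{d+1}$ be such that $2H_0+\sum_{i=1}^d H_i\le d+1$, and let $(\Psi_n)_{n\ge1}$ be the Gaussian process defined in the context. Then the quantity $\mathbb{E}[|\Psi_n(t,x)|^2]$ does not depend on $x$. Denoting $\sigma_n(t):=\mathbb{E}[|\Psi_n(t,x)|^2]$, there exist constants $c^1_H,c^2_H>0$ such that, for every $t\in(0,T]$ (and $x\in\mathbb{R}^d$), as $n\to\infty$, $$\sigma_n(t)\sim\begin{cases} c_H^1\,t\,n & \text{if } 2H_0+\sum_{i=1}^dH_i=d+1,\\ c_H^2\,t\,2^{2n(d+1-[2H_0+\sum_{i=1}^dH_i])} & \text{if } 2H_0+\sum_{i=1}^dH_i<d+1.\end{cases}$$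
   Context: $a_n\sim b_n$ means $a_n/b_n\to1$ as $n\to\infty$. For $t\ge0$, $\xi\in\mathbb{R}$, $r>0$ let $\gamma_t(\xi,r)=e^{\imath\xi t}\int_0^t e^{\imath s(r^2-\xi)}ds$. The process $\Psi_n$ is the solution of the linear equation $\imath\partial_t\Psi_n-\Delta\Psi_n=\dot B_n$, $\Psi_n(0,\cdot)=0$, where $\dot B_n=\partial_t\partial_{x_1}\cdots\partial_{x_d}B_n$ and $$B_n(t,x)= c_H\int_{|\xi|\leq 2^{2n}}\int_{|\eta|\leq 2^n} \frac{e^{\imath t\xi}-1}{|\xi|^{H_0+\frac{1}{2}}}\prod_{i=1}^{d}\frac{e^{\imath x_i\eta_i}-1}{|\eta_i|^{H_i+\frac{1}{2}}}\, \widehat{W}(d\xi,d\eta),$$ with $\widehat W$ the Fourier transform of a space-time white noise on $\mathbb{R}^{d+1}$ and $c_H>0$ the constant for which the same integral over all of $\mathbb{R}\times\mathbb{R}^d$ is a space-time fractional Brownian motion of Hurst index $H=(H_0,\dots,H_d)$ (centered Gaussian with covariance $R_{H_0}(s,t)\prod_{i=1}^dR_{H_i}(x_i,y_i)$, $R_h(a,b)=\frac12(|a|^{2h}+|b|^{2h}-|a-b|^{2h})$). By definition this solution is the centered complex Gaussian process $\{\Psi_n(s,x),\ n\ge1,\ s\ge0,\ x\in\mathbb{R}^d\}$ whose covariance is given, for all $n,m\ge1$, $s,t\ge0$, $x,y\in\mathbb{R}^d$, by $$\mathbb{E}[\Psi_n(s,x)\overline{\Psi_m(t,y)}]=c_H^2\int_{D_n\cap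 D_m}\frac{1}{|\xi|^{2H_0-1}}\prod_{i=1}^{d}\frac{1}{|\eta_i|^{2H_i-1}}\gamma_{s}(\xi,|\eta|)\overline{\gamma_{t}(\xi,|\eta|)}e^{\imath \langle \eta, x-y \rangle}\, d\xi d\eta,$$ $$\mathbb{E}[\Psi_n(s,x)\Psi_m(t,y)]=-c_H^2\int_{D_n\cap D_m}\frac{1}{|\xi|^{2H_0-1}}\prod_{i=1}^{d}\frac{1}{|\eta_i|^{2H_i-1}}\gamma_{s}(\xi,|\eta|)\gamma_{t}(-\xi,|\eta|)e^{\imath \langle \eta, x-y \rangle}\, d\xi d\eta,$$ where $D_n=\{(\xi,\eta)\in\mathbb{R}\times\mathbb{R}^d:\ |\xi|\le 2^{2n},\ |\eta|\le 2^n\}$. *)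

(* Defs.v *)
From HB Require Import structures.
From mathcomp Require Import all_boot all_order all_algebra.
From mathcomp Require Import all_classical all_reals all_analysis.
From mathcomp Require Import complex.

Set Implicit Arguments.
Unset Strict Implicit.
Unset Printing Implicit Defensive.

Import Order.TTheory GRing.Theory Num.Theory.
Import numFieldNormedType.Exports.

Local Open Scope classical_set_scope.
Local Open Scope ring_scope.
Local Open Scope complex_scope.

(* Points of R^d are tuples, which carry the product sigma-algebra. *)
Notation vecR R d := (d.-tuple (measurableTypeR R)).

Section lebesgue_measure_cons.
Context {R : realType} (n : nat).
Variable m : {sigma_finite_measure set (vecR R n) -> \bar R}.

Let cons_pair (p : measurableTypeR R * vecR R n) : vecR R n.+1 :=
  [the n.+1.-tuple _ of p.1 :: p.2].

Let measurable_cons_pair : measurable_fun setT cons_pair.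
Proof. exact: measurable_cons. Qed.

Definition lebesgue_cons : set (vecR R n.+1) -> \bar R :=
  pushforward (@lebesgue_measure R \x m)%E
    (fun p : measurableTypeR R * vecR R n => [the n.+1.-tuple _ of p.1 :: p.2]).

Let lebesgue_cons0 : lebesgue_cons set0 = 0%E.
Proof. by rewrite /lebesgue_cons /pushforward preimage_set0 measure0. Qed.

Let lebesgue_cons_ge0 A : (0 <= lebesgue_cons A)%E.
Proof. exact: measure_ge0. Qed.

Let lebesgue_cons_sigma_additive : semi_sigma_additive lebesgue_cons.
Proof.
move=> F mF tF mUF; rewrite /lebesgue_cons /pushforward preimage_bigcup.
apply: measure_semi_sigma_additive.
- by move=> k; rewrite -[X in measurable X]setTI; exact: measurable_cons_pair.
- apply/trivIsetP => /= i j _ _ ij; rewrite -preimage_setI.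
  by move/trivIsetP : tF => /(_ _ _ _ _ ij) ->//; rewrite preimage_set0.
- rewrite -preimage_bigcup -[X in measurable X]setTI.
  exact: measurable_cons_pair.
Qed.

HB.instance Definition _ := isMeasure.Build _ _ _ lebesgue_cons
  lebesgue_cons0 lebesgue_cons_ge0 lebesgue_cons_sigma_additive.

Let lebesgue_cons_sigma_finite : sigma_finite setT lebesgue_cons.
Proof.
have /sigma_finiteP[F [TF ndF Foo]] := sigma_finiteT (@lebesgue_measure R).
have /sigma_finiteP[G [TG ndG Goo]] := sigma_finiteT m.
pose uncons (v : vecR R n.+1) : measurableTypeR R * vecR R n :=
  (thead v, [tuple of behead v]).
have consK : cancel cons_pair uncons.
  by move=> [x v]; rewrite /uncons /cons_pair; congr pair; exact/val_inj.
have munc : measurable_fun setT uncons.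
  apply/measurable_fun_pairP; split => /=.
    exact: measurable_tnth.
  exact: measurable_behead.
exists (fun k => uncons @^-1` (F k `*` G k)).
  rewrite predeqE => v; split => // _.
  have [i _ Fi] : (\bigcup_k F k) (uncons v).1 by rewrite -TF.
  have [j _ Gj] : (\bigcup_k G k) (uncons v).2 by rewrite -TG.
  exists (maxn i j) => //; split.
    by move: Fi; exact/subsetPset/ndF/leq_maxl.
  by move: Gj; exact/subsetPset/ndG/leq_maxr.
move=> k; have [mF Fk] := Foo k; have [mG Gk] := Goo k; split.
  rewrite -[X in measurable X]setTI; apply: munc => //.
  exact: measurableX.
rewrite /lebesgue_cons /pushforward -comp_preimage.
rewrite (_ : uncons \o _ = id); last first.
  by apply/funext => p /=; exact: consK.
rewrite preimage_id product_measure1E//.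
by rewrite lte_mul_pinfty// ge0_fin_numE.
Qed.

HB.instance Definition _ := Measure_isSigmaFinite.Build _ _ _ lebesgue_cons
  lebesgue_cons_sigma_finite.

End lebesgue_measure_cons.

(* Lebesgue measure on R^n: the n-fold product of the one-dimensional one. *)
Fixpoint lebesgue_vec (R : realType) (n : nat) :
    {sigma_finite_measure set (vecR R n) -> \bar R} :=
  match n return {sigma_finite_measure set (vecR R n) -> \bar R} with
  | 0 => \d_ ([tuple] : vecR R 0)
  | k.+1 => lebesgue_cons (lebesgue_vec R k)
  end.

Lemma lebesgue_vec_box (R : realType) n (A : 'I_n -> set (measurableTypeR R)) :
  (forall i, measurable (A i)) ->
  lebesgue_vec R n [set v | forall i, A i (tnth v i)] =
  (\prod_(i < n) lebesgue_measure (A i))%E.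
Proof.
elim: n A => [|n IHn] A mA.
  by rewrite big_ord0 /= diracE mem_set// => -[].
rewrite big_ord_recl /= /lebesgue_cons /pushforward -IHn//.
have mB : measurable [set v : vecR R n | forall i, A (lift ord0 i) (tnth v i)].
  rewrite [X in measurable X](_ : _ =
    \bigcap_(i in [set: 'I_n]) ((@tnth n _ ^~ i) @^-1` A (lift ord0 i))).
    apply: fin_bigcap_measurable => // i _.
    rewrite -[X in measurable X]setTI; exact: measurable_tnth.
  by apply/seteqP; split => v /= Av i; [move=> _|]; exact: Av.
rewrite -product_measure1E//; congr (_ _); apply/seteqP; split => -[x v] /=.
  move=> Axv; split; first exact: (Axv ord0).
  by move=> i; have := Axv (lift ord0 i); rewrite tnthS.
move=> [Ax Av] i; case: (unliftP ord0 i) => [j ->|->] //.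
by rewrite tnthS.
Qed.

Section complex_integral.
Context {R : realType}.

Definition expi (a : R) : R[i] := cos a +i* sin a.

Definition cintegral d (T : measurableType d) (mu : {measure set T -> \bar R})
    (D : set T) (f : T -> R[i]) : R[i] :=
  Rintegral mu D (fun x => complex.Re (f x)) +i*
  Rintegral mu D (fun x => complex.Im (f x)).

Definition cexpectation d (T : measurableType d) (P : probability T R)
    (X : T -> R[i]) : R[i] :=
  fine 'E_P[fun w => complex.Re (X w)] +i* fine 'E_P[fun w => complex.Im (X w)].

End complex_integral.

Section gaussian.
Context {R : realType} d (T : measurableType d) (P : probability T R).

(* [normal_prob 0 0] is a junk value in the library: variance zero has to be
   treated separately, as the Dirac mass at the origin. *)
Definition centered_normal (Y : T -> R) : Prop :=
  measurable_fun setT Y /\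
  exists s : R, 0 <= s /\
    forall V : set (measurableTypeR R), measurable V ->
      P (Y @^-1` V) =
        if s == 0 then \d_ (0 : measurableTypeR R) V else normal_prob 0 s V.

(* The real and imaginary parts of the variables [X i], [i] in [D], are jointly
   centered Gaussian. *)
Definition centered_complex_gaussian_process (I : Type) (D : set I)
    (X : I -> T -> R[i]) : Prop :=
  forall (k : nat) (i : 'I_k -> I) (a b : 'I_k -> R), (forall j, D (i j)) ->
    centered_normal (fun w => \sum_(j < k)
      (a j * complex.Re (X (i j) w) + b j * complex.Im (X (i j) w))).

End gaussian.

Section vectors.
Context {R : realType} (d : nat).

Definition dotv (u v : vecR R d) : R := \sum_(i < d) tnth u i * tnth v i.

Definition subv (u v : vecR R d) : vecR R d :=
  [tuple (tnth u i - tnth v i : R) | i < d].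

Definition enorm (v : vecR R d) : R := Num.sqrt (dotv v v).

Definition lebesgue_spacetime :
    {measure set (measurableTypeR R * vecR R d) -> \bar R} :=
  (@lebesgue_measure R \x lebesgue_vec R d)%E.

End vectors.

(* A Hurst index [H : 'I_d.+1 -> R] is (H_0, ..., H_d): [H ord0] is the time
   index H_0 and [H (lift ord0 i)], [i : 'I_d], are the space indices. *)
Section fractional_noise.
Context {R : realType} (d : nat) (H : 'I_d.+1 -> R).

Definition hurst_sum : R := 2 * H ord0 + \sum_(i < d) H (lift ord0 i).

Definition fbm_cov (h a b : R) : R :=
  (`|a| `^ (2 * h) + `|b| `^ (2 * h) - `|a - b| `^ (2 * h)) / 2.

Definition fbm_kernel (t : R) (x : vecR R d)
    (p : measurableTypeR R * vecR R d) : R[i] :=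
  (expi (t * p.1) - 1) / (`|p.1 : R| `^ (H ord0 + 2^-1))%:C *
  \prod_(i < d) ((expi (tnth x i * tnth p.2 i) - 1) /
                 (`|tnth p.2 i : R| `^ (H (lift ord0 i) + 2^-1))%:C).

(* [c] is the normalising constant of the harmonizable representation: the
   field (t, x) |-> c * \int fbm_kernel t x dW^, with W^ the Fourier transform
   of a white noise, is a space-time fractional Brownian motion.  A stochastic
   integral against W^ is automatically centered Gaussian, so only its
   covariance matters; the isometry E[W^(f) (W^(g))^*] = \int f g^* gives it. *)
Definition fbm_constant (c : R) : Prop :=
  0 < c /\
  forall (s t : R) (x y : vecR R d),
    (c ^+ 2)%:C * cintegral (lebesgue_spacetime d) setT
      (fun p => fbm_kernel s x p * (fbm_kernel t y p)^*) =
    (fbm_cov (H ord0) s t *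
     \prod_(i < d) fbm_cov (H (lift ord0 i)) (tnth x i) (tnth y i))%:C.

Definition gamma (t xi r : R) : R[i] :=
  expi (xi * t) *
  cintegral (@lebesgue_measure R) `[0, t] (fun s => expi (s * (r ^+ 2 - xi))).

Definition freq_domain (n : nat) : set (measurableTypeR R * vecR R d) :=
  [set p | `|p.1 : R| <= 2 ^+ (2 * n) /\ enorm p.2 <= 2 ^+ n].

Definition spectral_density (p : measurableTypeR R * vecR R d) : R :=
  (`|p.1 : R| `^ (2 * H ord0 - 1))^-1 *
  \prod_(i < d) (`|tnth p.2 i : R| `^ (2 * H (lift ord0 i) - 1))^-1.

Definition linear_cov (c : R) (n m : nat) (s t : R) (x y : vecR R d) : R[i] :=
  (c ^+ 2)%:C * cintegral (lebesgue_spacetime d)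
    (freq_domain n `&` freq_domain m)
    (fun p => (spectral_density p)%:C *
      gamma s p.1 (enorm p.2) * (gamma t p.1 (enorm p.2))^* *
      expi (dotv p.2 (subv x y))).

Definition linear_pseudocov (c : R) (n m : nat) (s t : R) (x y : vecR R d) :
    R[i] :=
  - (c ^+ 2)%:C * cintegral (lebesgue_spacetime d)
    (freq_domain n `&` freq_domain m)
    (fun p => (spectral_density p)%:C *
      gamma s p.1 (enorm p.2) * gamma t (- (p.1 : R)) (enorm p.2) *
      expi (dotv p.2 (subv x y))).

(* [Psi n s x] is the solution, started from 0, of the linear Schroedinger
   equation driven by the regularised noise of level [n]; only the values at
   [n >= 1], [s >= 0] are meaningful. *)
Definition linear_solution dO (Omega : measurableType dO)
    (P : probability Omega R) (c : R)
    (Psi : nat -> R -> vecR R d -> Omega -> R[i]) : Prop :=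
  [/\ centered_complex_gaussian_process P
        [set i : nat * R * vecR R d | (1 <= i.1.1)%N /\ 0 <= i.1.2]
        (fun i => Psi i.1.1 i.1.2 i.2),
      forall n m s t x y, (1 <= n)%N -> (1 <= m)%N -> 0 <= s -> 0 <= t ->
        cexpectation P (fun w => Psi n s x w * (Psi m t y w)^*) =
        linear_cov c n m s t x y &
      forall n m s t x y, (1 <= n)%N -> (1 <= m)%N -> 0 <= s -> 0 <= t ->
        cexpectation P (fun w => Psi n s x w * Psi m t y w) =
        linear_pseudocov c n m s t x y].

Definition second_moment dO (Omega : measurableType dO)
    (P : probability Omega R) (X : Omega -> R[i]) : \bar R :=
  'E_P[fun w => ComplexField.Normc.normc (X w) ^+ 2].

End fractional_noise.

Definition asymp_equiv (R : realType) (a b : nat -> R) : Prop :=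
  a n / b n @[n --> \oo] --> (1 : R).

(* Main.v *)
From HB Require Import structures.
Require Import Defs.
From mathcomp Require Import all_boot all_order all_algebra.
From mathcomp Require Import all_classical all_reals all_analysis.
From mathcomp Require Import measurable_realfun complex.
From mathcomp Require Import ring lra.

Import Order.TTheory GRing.Theory Num.Theory.
Import numFieldNormedType.Exports.
Local Open Scope classical_set_scope.
Local Open Scope ring_scope.

Set Implicit Arguments.
Unset Strict Implicit.
Unset Printing Implicit Defensive.

(** The covariance depends on the space variables only through x - y, so at
    x = y it does not see x.  There the complex integrand is the spectral
    density times |gamma_t(xi, |eta|)|^2, and the latter equals
    K_t(|eta|^2 - xi) with K_t(a) = (2 - 2 cos(t a)) / a^2, a Fejer kernel: it
    decays like 1 / a^2 and K_t(a) = t^2 K_1(t a), so its total mass is t times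
    that of K_1.  This is the origin of the factor t in the answer.  The second
    moment is therefore c^2 E_n, where E_n ([energy]) is the integral of
    density * K_t(|eta|^2 - xi) over D_n.

    The growth of E_n is read off dyadic shells.  The parabolic dilation
    (xi, eta) |-> (4^n xi, 2^n eta) maps D_1 \ D_0 onto D_(n+1) \ D_n and
    multiplies density * volume by 4^n 4^(n beta), where
    beta = d + 1 - (2 H_0 + H_1 + ... + H_d).  Hence ([energyS])
      E_(n+1) = E_n + q^n u_n,   q = 4^beta,
    where u_n is the integral over the fixed shell D_1 \ D_0 of the density
    against 4^n K_t(4^n (|eta|^2 - xi)).  As n grows the rescaled kernel
    concentrates on the paraboloid xi = |eta|^2, so u_n converges ([shell_cvg])
    to t k J, where k is the mass of K_1 and J > 0 is the integral over
    1 < |eta| <= 2 of the density on the paraboloid.  If beta = 0 then q = 1 and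
    Cesaro's lemma gives E_n ~ t k J n; if beta > 0 then q > 1 and the recurrence
    gives E_n ~ t k J q^n / (q - 1).  The same shell argument serves both cases,
    and it never meets the origin, where the density restricted to the
    paraboloid is not integrable in the critical case.

    For the limit of u_n, the shell is cut at | |eta|^2 - xi | = 1/3.  On the
    nonresonant side the rescaled kernel is O(4^-n) while the density is
    integrable on bounded sets, all its exponents 1 - 2 H_i being larger than -1.
    On the resonant side xi > 1/3, so the substitution xi = |eta|^2 + y / 4^n
    yields an integrand dominated by a constant times K_t(y) and the space part
    of the density.  It converges except when |eta| is 1 or 2, and spheres
    are null sets because balls scale.

    Gaussianity enters only through finiteness of the second moments: it turns
    equality of the real values of the moments at x and y into equality of
    extended reals. *)

(** * Generalities on integrals *)

Lemma measurable_patch d (T : measurableType d) (R : realType) (D : set T)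
    (f : T -> \bar R) :
  measurable D -> measurable_fun setT f -> measurable_fun setT (f \_ D).
Proof.
move=> mD mf; have [h _] := measurable_restrictT f mD; apply: h.
exact: measurable_funTS.
Qed.

Lemma integral_gt0 d (T : measurableType d) (R : realType)
    (mu : {measure set T -> \bar R}) (D : set T) (f : T -> \bar R) :
  measurable D -> measurable_fun D f -> (forall x, D x -> 0 < f x)%E ->
  (0 < mu D)%E -> (0 < \int[mu]_(x in D) f x)%E.
Proof.
move=> mD mf f0 D0; rewrite lt0e integral_ge0 ?andbT; last by move=> x /f0/ltW.
apply/negP => /eqP I0.
have : ae_eq mu D f (cst 0%E).
  apply/ae_eq_integral_abs => //; rewrite -I0; apply: eq_integral => x.
  by rewrite inE => /f0/ltW/gee0_abs.
move=> [N [mN N0 DN]].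
have : (mu D <= mu N)%E.
  apply: le_measure; rewrite ?inE// => x Dx; apply: DN => /= /(_ Dx) fx0.
  by move: (f0 _ Dx); rewrite fx0 ltxx.
by rewrite N0 leNgt D0.
Qed.

Lemma integral_indicE d (T : measurableType d) (R : realType)
    (mu : {measure set T -> \bar R}) (D : set T) (f : T -> R) :
  (\int[mu]_(x in D) (f x)%:E = \int[mu]_x (\1_D x * f x)%:E)%E.
Proof.
rewrite integral_mkcond; apply: eq_integral => x _.
rewrite /patch indicE; case: ifPn => xD; first by rewrite mul1r.
by rewrite mul0r.
Qed.

Lemma integral_prod_mul d1 d2 (T1 : measurableType d1) (T2 : measurableType d2)
    (R : realType) (m1 : {sigma_finite_measure set T1 -> \bar R})
    (m2 : {sigma_finite_measure set T2 -> \bar R}) (f : T1 -> R) (g : T2 -> R) :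
  measurable_fun setT f -> measurable_fun setT g ->
  (forall x, 0 <= f x) -> (forall y, 0 <= g y) ->
  (\int[m1 \x m2]_p (f p.1 * g p.2)%:E =
   (\int[m1]_x (f x)%:E) * (\int[m2]_y (g y)%:E))%E.
Proof.
move=> mf mg f0 g0.
have mfg : measurable_fun setT (fun p : T1 * T2 => (f p.1 * g p.2)%:E).
  apply/measurable_EFinP; apply: measurable_funM.
    exact: measurableT_comp mf measurable_fst.
  exact: measurableT_comp mg measurable_snd.
rewrite fubini_tonelli1//; last by move=> p; rewrite lee_fin mulr_ge0.
rewrite /fubini_F/=.
under eq_integral => x _.
  under eq_integral do rewrite EFinM.
  rewrite ge0_integralZl_EFin//; last 2 first.
  - by move=> y _; rewrite lee_fin.
  - exact/measurable_EFinP.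
  over.
rewrite ge0_integralZr//.
- exact/measurable_EFinP.
- by move=> x _; rewrite lee_fin.
- by apply: integral_ge0 => y _; rewrite lee_fin.
Qed.

(** * Linear changes of variables *)

Section change_of_variables.
Context {R : realType}.
Local Notation mu := (@lebesgue_measure R).

(** Uniqueness of Lebesgue measure reduces the change of variables to the
    measure of half-open intervals. *)
Lemma integral_affine (a b : R) (f : R -> \bar R) :
  0 < a -> measurable_fun [set: R] f -> (forall x, 0 <= f x)%E ->
  (\int[mu]_x f x = a%:E * \int[mu]_x f (a * x + b)%R)%E.
Proof.
move=> a0 mf f0.
have mphi : measurable_fun setT
    (fun x : measurableTypeR R => (a * x + b : measurableTypeR R)).
  by apply: measurable_funD => //; apply: measurable_funM.
pose mphi' := isMeasurableFun.Build _ _ _ _ _ mphi.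
pose phi : {mfun measurableTypeR R >-> measurableTypeR R} :=
  HB.pack (fun x : measurableTypeR R => (a * x + b : measurableTypeR R)) mphi'.
rewrite (@eq_measure_integral _ _ _ setT
    (mscale (NngNum (ltW a0)) (pushforward mu phi))); last first.
  move=> A mA _; apply: lebesgue_measure_unique => // _ [[u v]] _ <-.
  change (mu `]u, v]%classic =
    a%:E * mu ((fun x : R => a * x + b)%R @^-1` `]u, v]%classic))%E.
  have -> : (fun x : R => a * x + b) @^-1` `]u, v]%classic =
      `](u - b) / a, (v - b) / a]%classic.
    apply/seteqP; split => x /=; rewrite !in_itv/= ltr_pdivrMr// ler_pdivlMr//;
    by rewrite ltrBlDr lerBrDr mulrC.
  rewrite !lebesgue_measure_itv/= !lte_fin ltr_pM2r ?invr_gt0// ltrD2r.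
  case: ifPn => _; last by rewrite mule0.
  by rewrite -!EFinB -EFinM; congr EFin; field; rewrite gt_eqF.
rewrite ge0_integral_mscale//; congr (_ * _)%E.
by rewrite ge0_integral_pushforward.
Qed.

Lemma measurable_mktuple d (T : measurableType d) n
    (f : T -> vecR R n) :
  (forall i, measurable_fun setT (fun x => tnth (f x) i)) ->
  measurable_fun setT f.
Proof. by move=> h; apply/measurable_fun_tnthP. Qed.

Lemma ge0_integral_lebesgue_vecS n (f : vecR R n.+1 -> \bar R) :
  measurable_fun setT f -> (forall x, 0 <= f x)%E ->
  (\int[lebesgue_vec R n.+1]_v f v =
   \int[mu]_x \int[lebesgue_vec R n]_v f [tuple of x :: v])%E.
Proof.
move=> mf f0.
have mphi : measurable_fun setT (fun p : measurableTypeR R * vecR R n =>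
    [the n.+1.-tuple _ of p.1 :: p.2]).
  exact: measurable_cons.
transitivity (\int[pushforward (mu \x lebesgue_vec R n)%E
   (fun p : measurableTypeR R * vecR R n => [the n.+1.-tuple _ of p.1 :: p.2])]_v f v)%E.
  exact: eq_measure_integral.
rewrite ge0_integral_pushforward//= preimage_setT fubini_tonelli1//.
exact: measurableT_comp.
Qed.

Definition scalev n (r : R) (v : vecR R n) : vecR R n :=
  [tuple (r * tnth v i : R) | i < n].

Lemma measurable_scalev n r : measurable_fun setT (@scalev n r).
Proof.
apply: measurable_mktuple => i.
under eq_fun do rewrite tnth_mktuple.
by apply: measurable_funM => //; exact: measurable_tnth.
Qed.

Lemma scalev_cons n r x (v : vecR R n) :
  scalev r [tuple of x :: v] = [tuple of r * x :: scalev r v].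
Proof.
apply: eq_from_tnth => i; rewrite tnth_mktuple.
case: (unliftP ord0 i) => [j ->|->]; last by rewrite !tnth0.
by rewrite !tnthS tnth_mktuple.
Qed.

Lemma integral_lebesgue_vec_scale n (r : R) (f : vecR R n -> \bar R) :
  0 < r -> measurable_fun setT f -> (forall x, 0 <= f x)%E ->
  (\int[lebesgue_vec R n]_v f v =
   (r ^+ n)%:E * \int[lebesgue_vec R n]_v f (scalev r v))%E.
Proof.
move=> r0; elim: n f => [|n IH] f mf f0.
  rewrite expr0 mul1e; apply: eq_integral => v _; congr (f _).
  by rewrite (tuple0 v) (tuple0 (scalev _ _)).
have mc : measurable_fun setT (fun p : measurableTypeR R * vecR R n =>
    [the n.+1.-tuple _ of p.1 :: p.2]).
  exact: measurable_cons.
have mcx x : measurable_fun setT (fun v : vecR R n =>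
    [the n.+1.-tuple (measurableTypeR R) of x :: v]).
  exact: measurable_cons.
have mI (g : vecR R n.+1 -> \bar R) : measurable_fun setT g -> (forall x, 0 <= g x)%E ->
    measurable_fun setT (fun x => \int[lebesgue_vec R n]_v g [tuple of x :: v])%E.
  move=> mg g0.
  exact: (@measurable_fun_fubini_tonelli_F _ _ _ _ _ (lebesgue_vec R n)
    (fun p : measurableTypeR R * vecR R n => g [tuple of p.1 :: p.2])
    (measurableT_comp mg mc) (fun=> g0 _)).
rewrite ge0_integral_lebesgue_vecS// (@integral_affine r 0)//; last 2 first.
- exact: mI.
- by move=> x; exact: integral_ge0.
under eq_integral => x _.
  rewrite addr0 (IH (fun v => f [tuple of r * x :: v]))//; last first.
    exact: measurableT_comp mf (mcx (r * x)).
  over.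
have msc := @measurable_scalev n.+1 r.
rewrite (@ge0_integral_lebesgue_vecS n (fun v => f (scalev r v)))//; last first.
  exact: (@measurableT_comp _ _ _ _ _ _ f _ _ mf msc).
under [in RHS]eq_integral => x _.
  under eq_integral do rewrite scalev_cons.
  over.
rewrite ge0_integralZl_EFin//=.
- by rewrite muleA -EFinM -exprS.
- by move=> x _; apply: integral_ge0 => //.
- under eq_fun => x.
    under eq_integral do rewrite -scalev_cons.
    over.
  by apply: (mI (fun v => f (scalev r v))) => //; exact: (measurableT_comp mf msc).
- by rewrite exprn_ge0// ltW.
Qed.

(** The tool for testing finiteness of integrals of products of powers of the
    coordinates: such integrals reduce to dimension one. *)
Lemma integral_lebesgue_vec_prod n (g : 'I_n -> R -> R) :
  (forall i, measurable_fun setT (g i)) -> (forall i x, 0 <= g i x) ->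
  (\int[lebesgue_vec R n]_v (\prod_(i < n) g i (tnth v i))%:E =
   \prod_(i < n) \int[mu]_x (g i x)%:E)%E.
Proof.
elim: n g => [|n IH] g mg g0.
  rewrite big_ord0; under eq_integral do rewrite big_ord0.
  by rewrite integral_cst//= diracT mule1.
have mp k (h : 'I_k -> R -> R) : (forall i, measurable_fun setT (h i)) ->
    measurable_fun setT (fun v : vecR R k => (\prod_(i < k) h i (tnth v i))%:E).
  move=> mh; apply/measurable_EFinP; apply: measurable_prod => i _.
  exact: (measurableT_comp (mh i) (@measurable_tnth _ _ k i)).
rewrite ge0_integral_lebesgue_vecS//; last 2 first.
- exact: mp.
- by move=> v; rewrite lee_fin; exact: prodr_ge0.
under eq_integral => x _.
  under eq_integral => v _.
    rewrite big_ord_recl tnth0 (eq_bigr _ (fun i _ => congr1 _ (tnthS x v i))).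
    rewrite EFinM.
    over.
  rewrite /= ge0_integralZl//; last 3 first.
  - exact: (mp _ (fun i => g (lift ord0 i))).
  - by move=> v _; rewrite lee_fin; exact: prodr_ge0.
  - by rewrite lee_fin.
  rewrite (IH (fun i => g (lift ord0 i)))//.
  over.
rewrite ge0_integralZr//; last 3 first.
- by apply/measurable_EFinP; exact: mg.
- by move=> x _; rewrite lee_fin.
- elim/big_ind : _ => //; first exact: mule_ge0.
  by move=> i _; apply: integral_ge0 => x _; rewrite lee_fin.
by rewrite [RHS]big_ord_recl.
Qed.

End change_of_variables.

(** * Integrability of powers *)

Section power.
Context {R : realType}.
Local Notation mu := (@lebesgue_measure R).

Lemma measurable_norm_powR (e : R) :
  measurable_fun [set: R] (fun x : R => `|x| `^ e).
Proof.
exact: (measurableT_comp (@measurable_powR R e) (@normr_measurable R setT)).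
Qed.

Lemma measurable_norm_le (b : R) : measurable [set x : R | `|x| <= b].
Proof.
rewrite (_ : [set _ | _] = `[- b, b]%classic); first exact: measurable_itv.
by apply/seteqP; split => x /=; rewrite in_itv/= ler_norml.
Qed.

Lemma measurable_norm_gt (b : R) : measurable [set x : R | b < `|x|].
Proof.
rewrite (_ : [set _ | _] = ~` [set x : R | `|x| <= b]).
  by apply: measurableC; exact: measurable_norm_le.
by apply/seteqP; split => x /=; rewrite ltNge => /negP.
Qed.

Let shell (b : R) k : set R := [set x | b / 2 ^+ k.+1 < `|x| <= b / 2 ^+ k].

Let measurable_shell b k : measurable (shell b k).
Proof.
rewrite (_ : shell b k =
    [set x : R | b / 2 ^+ k.+1 < `|x|] `&` [set x : R | `|x| <= b / 2 ^+ k]).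
  by apply: measurableI; [exact: measurable_norm_gt|exact: measurable_norm_le].
by apply/seteqP; split => [x /andP[]|x [h1 h2]] //; apply/andP; split.
Qed.

Let trivIset_shell b : 0 < b -> trivIset setT (shell b).
Proof.
move=> b0; apply: ltn_trivIset => i j ij.
apply/seteqP; split => // x [/andP[xi _] /andP[_ xj]].
have : b / 2 ^+ i <= b / 2 ^+ j.+1.
  rewrite ler_pM2l// lef_pV2 ?posrE ?exprn_gt0//. by rewrite ler_eXn2l ?ltr1n.
by rewrite leNgt (lt_le_trans xi xj).
Qed.

Let bigcup_shell b : 0 < b -> \bigcup_k shell b k = [set x : R | `|x| <= b] `\ 0.
Proof.
move=> b0; apply/seteqP; split => [x [k _ /andP[kx xk]]|x [/= xb x0]].
  split => /=.
    rewrite (le_trans xk)// ler_pdivrMr ?exprn_gt0// ler_peMr//; first exact: ltW.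
    exact: exprn_ege1 (ler1n _ 2).
  apply/eqP; rewrite -normr_gt0 (le_lt_trans _ kx)//.
  by rewrite divr_ge0 ?exprn_ge0// ltW.
have nx0 : 0 < `|x| by rewrite normr_gt0; exact/eqP.
have ex : exists k, b / 2 ^+ k.+1 < `|x|.
  exists (Num.bound (b / `|x|)); rewrite ltr_pdivrMr ?exprn_gt0// mulrC -ltr_pdivrMr//.
  rewrite (lt_trans (archi_boundP _))// ?divr_ge0// ?ltW// -natrX ltr_nat.
  exact: (ltn_trans (ltnSn _) (ltn_expl _ _)).
case: (ex_minnP ex) => k kx kmin; exists k => //; apply/andP; split => //.
case: k kx kmin => [|k] _ kmin; first by rewrite expr0 divr1.
rewrite leNgt; apply/negP => /kmin; by rewrite ltnn.
Qed.

Let integral_shell (e b : R) k :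
  (\int[mu]_(x in shell b k.+1) (`|x| `^ e)%:E =
   (2^-1 `^ (1 + e))%:E * \int[mu]_(x in shell b k) (`|x| `^ e)%:E)%E.
Proof.
have mf : measurable_fun [set: R] (fun x : R => (`|x| `^ e)%:E).
  by apply/measurable_EFinP; exact: measurable_norm_powR.
rewrite integral_mkcond (@integral_affine R 2^-1 0); last 3 first.
- by rewrite invr_gt0.
- by apply: measurable_patch => //; exact: (measurable_shell b k.+1).
- by move=> x; apply: erestrict_ge0 => y _; rewrite lee_fin powR_ge0.
rewrite (@powRD _ 2^-1 1 e) ?invr_eq0 ?pnatr_eq0 ?implybT// powRr1//.
rewrite EFinM -muleA; congr (_ * _)%E.
rewrite -ge0_integralZl_EFin ?powR_ge0//; last 2 first.
- exact: (measurable_shell b k).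
- exact: measurable_funTS.
rewrite [RHS]integral_mkcond; apply: eq_integral => x _.
rewrite /patch addr0.
have -> : (2^-1 * x \in shell b k.+1) = (x \in shell b k).
  have E j : b / 2 ^+ j.+1 = 2^-1 * (b / 2 ^+ j) by rewrite exprS invfM mulrCA.
  apply/idP/idP; rewrite !inE /shell/= normrM ger0_norm//;
    by rewrite !E !(ltr_pM2l, ler_pM2l).
case: ifPn => // _; by rewrite normrM ger0_norm// powRM// EFinM.
Qed.

(** The shells b / 2^(k+1) < |x| <= b / 2^k are dilates of one another, so their
    contributions form a geometric series of ratio 2^-(1 + e) < 1; this avoids
    primitives and the improper endpoint 0. *)
Lemma integral_norm_powR_lty (e b : R) : -1 < e -> 0 < b ->
  (\int[mu]_(x in [set x : R | (`|x| <= b)%R]) (`|x| `^ e)%:E < +oo)%E.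
Proof.
move=> e1 b0.
have mf : measurable_fun [set: R] (fun x : R => (`|x| `^ e)%:E).
  by apply/measurable_EFinP; exact: measurable_norm_powR.
rewrite -(@integral_setD1 _ _ 0); last 2 first.
- by apply: measurableD => //; exact: measurable_norm_le.
- exact: measurable_funTS.
rewrite -bigcup_shell// ge0_integral_bigcup//; last 3 first.
- exact: measurable_shell.
- exact: measurable_funTS.
- exact: trivIset_shell.
(* The power is monotone on the shell, increasing or decreasing with the sign of e. *)
pose M := Num.max ((b / 2) `^ e) (b `^ e).
have S0 : (\int[mu]_(x in shell b 0) (`|x| `^ e)%:E < +oo)%E.
  have : (\int[mu]_(x in shell b 0) `|(`|x| `^ e)%:E| <= M%:E * mu (shell b 0))%E.
    apply: integral_le_bound => //.
    - exact: measurable_shell.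
    - exact: measurable_funTS.
    - by rewrite lee_fin le_max powR_ge0.
    apply/aeW => x /andP[]; rewrite expr1 expr0 divr1 => bx xb.
    rewrite gee0_abs ?lee_fin ?powR_ge0// le_max.
    have [e0|e0] := leP 0 e.
      by apply/orP; right; apply: ge0_ler_powR => //; rewrite nnegrE ltW.
    have b20 : 0 < b / 2 by rewrite divr_gt0.
    have nx0 : 0 < `|x| by rewrite (lt_trans _ bx).
    have : (b / 2) `^ (- e) <= `|x| `^ (- e).
      by apply: ge0_ler_powR; rewrite ?oppr_ge0 ?nnegrE ltW.
    by rewrite !powRN lef_pV2 ?posrE ?powR_gt0// => ->.
  under eq_integral do rewrite gee0_abs ?lee_fin ?powR_ge0//.
  move=> /le_lt_trans; apply; rewrite lte_mul_pinfty ?lee_fin ?le_max ?powR_ge0//.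
  rewrite (@le_lt_trans _ _ (mu `[(- b)%R, b]%classic))//; last first.
    by rewrite /= lebesgue_measure_itv/=; case: ifPn => _; rewrite ?ltry// -EFinD ltry.
  apply: le_measure; rewrite ?inE//; first exact: measurable_shell.
  by move=> x /andP[_]; rewrite expr0 divr1 /= in_itv/= ler_norml.
pose q : R := 2^-1 `^ (1 + e).
have q0 : 0 < q by rewrite powR_gt0.
have q1 : `|q| < 1.
  have e10 : 0 < 1 + e by lra.
  rewrite ger0_norm ?powR_ge0// -[ltRHS](congr1 (fun h => h (1 + e)) (@powR1 R)).
  by apply: gt0_ltr_powR; rewrite ?nnegrE ?invr_ge0 ?invf_lt1 ?ltr1n.
have S k : (\int[mu]_(x in shell b k) (`|x| `^ e)%:E =
    (fine (\int[mu]_(x in shell b 0) (`|x| `^ e)%:E) * q ^+ k)%:E)%E.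
  elim: k => [|k IH].
    by rewrite expr0 mulr1 fineK// ge0_fin_numE// integral_ge0// => x _;
      rewrite lee_fin powR_ge0.
  by rewrite integral_shell IH -EFinM mulrCA -exprS.
set a := fine _ in S.
have a0 : 0 <= a by rewrite fine_ge0// integral_ge0// => x _; rewrite lee_fin powR_ge0.
apply: (@le_lt_trans _ _ (a * (1 - q)^-1)%:E); last exact: ltry.
apply: lime_le.
  apply: is_cvg_nneseries => n _ _; apply: integral_ge0 => x _.
  by rewrite lee_fin powR_ge0.
apply: nearW => n; under eq_bigr do rewrite S.
rewrite sumEFin lee_fin.
exact: (geometric_le_lim n a0 q0 q1).
Qed.

End power.

(** * The Fejer kernel *)

Section fejer_kernel.
Context {R : realType}.
Local Notation mu := (@lebesgue_measure R).

(** |\int_0^t e^(i s x) ds|^2, an unnormalised Fejer kernel. *)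
Definition fejer (t x : R) : R :=
  if x == 0 then t ^+ 2 else (2 - 2 * cos (t * x)) / x ^+ 2.

Lemma fejer_ge0 t x : 0 <= fejer t x.
Proof.
rewrite /fejer; case: ifPn => _; first exact: sqr_ge0.
apply: divr_ge0; last exact: sqr_ge0.
by have := cos_le1 (t * x); lra.
Qed.

Lemma measurable_fejer t : measurable_fun [set: R] (fejer t).
Proof.
apply: measurable_fun_if => //.
- apply: (measurable_fun_bool true) => //=.
  rewrite setTI (_ : _ @^-1` _ = [set 0]); first exact: measurable_set1.
  by apply/seteqP; split => x /= => [/eqP|->]//; rewrite eqxx.
- apply: measurable_funTS; apply: measurable_funM.
    apply: measurable_funB => //; apply: measurable_funM => //.
    apply: (measurableT_comp (continuous_measurable_fun (@continuous_cos R))).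
    exact: measurable_funM.
  rewrite (_ : (fun x : R => (x ^+ 2)^-1) = (fun x => (x ^+ 2) `^ (-1))).
    exact: (measurableT_comp (@measurable_powR R (-1)) (exprn_measurable _)).
  by apply/funext => x; rewrite powR_inv1 ?sqr_ge0.
Qed.

Lemma fejerN t x : fejer t (- x) = fejer t x.
Proof. by rewrite /fejer oppr_eq0 mulrN cosN sqrrN. Qed.

(** The homogeneity that makes the total mass of the kernel linear in t. *)
Lemma fejer_scale t x : 0 < t -> fejer t x = t ^+ 2 * fejer 1 (t * x).
Proof.
move=> t0; rewrite /fejer mulf_eq0 (gt_eqF t0)/=.
have [_|x0] := eqVneq x 0; first by rewrite expr1n mulr1.
by rewrite mul1r exprMn; field; rewrite x0 gt_eqF.
Qed.

Lemma fejer_le t x : x != 0 -> fejer t x <= 4 / x ^+ 2.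
Proof.
move=> x0; rewrite /fejer (negbTE x0) ler_pM2r ?invr_gt0 ?exprn_even_gt0//.
by have := cos_geN1 (t * x); lra.
Qed.

Lemma is_derive_mulr (x s : R) : is_derive s 1 (fun s : R => s * x) x.
Proof.
have := is_deriveM (@is_derive_id R R^o s 1) (@is_derive_cst R R^o R^o x s 1).
by rewrite /GRing.scale/= mulr0 add0r mulr1.
Qed.

Lemma is_derive_affine_sin (x s : R) : x != 0 ->
  is_derive s 1 (fun s : R => x^-1 * sin (s * x)) (cos (s * x)).
Proof.
move=> x0.
have h := @is_derive1_comp R sin (fun s => s * x) s _ _
  (is_derive_sin (s * x)) (is_derive_mulr x s).
have := @is_deriveZ R R^o R^o _ x^-1 s 1 _ h.
by rewrite /GRing.scale/= (mulrC _ x) mulKf.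
Qed.

Lemma is_derive_affine_cos (x s : R) : x != 0 ->
  is_derive s 1 (fun s : R => - x^-1 * cos (s * x)) (sin (s * x)).
Proof.
move=> x0.
have h := @is_derive1_comp R cos (fun s => s * x) s _ _
  (is_derive_cos (s * x)) (is_derive_mulr x s).
have := @is_deriveZ R R^o R^o _ (- x^-1) s 1 _ h.
by rewrite /GRing.scale/= (mulrC _ x) mulrN mulNr mulrN opprK mulKf.
Qed.

Lemma continuous_affine_cos (x : R) : continuous (fun s : R => cos (s * x)).
Proof.
move=> s; apply: continuous_comp; last exact: continuous_cos.
by apply: cvgM; [exact: cvg_id|exact: cvg_cst].
Qed.

Lemma continuous_affine_sin (x : R) : continuous (fun s : R => sin (s * x)).
Proof.
move=> s; apply: continuous_comp; last exact: continuous_sin.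
by apply: cvgM; [exact: cvg_id|exact: cvg_cst].
Qed.

Lemma Rintegral_FTC2 (f F : R -> R) (t : R) : 0 < t -> continuous f ->
  (forall s : R, is_derive s 1 F (f s)) ->
  Rintegral mu `[0, t] f = F t - F 0.
Proof.
move=> t0 cf dF.
have cF : continuous F.
  by move=> s; apply/differentiable_continuous/derivable1_diffP/ex_derive.
rewrite /Rintegral (@continuous_FTC2 _ f F)//.
- exact: continuous_subspaceT.
- split => [s _||]; first exact: ex_derive.
  + by apply: cvg_at_right_filter; exact: cF.
  + by apply: cvg_at_left_filter; exact: cF.
- by move=> s _; rewrite derive1E; apply: derive_val.
Qed.

Lemma Rintegral_itv_le (f : R -> R) (t : R) : 0 < t -> continuous f ->
  (forall s, `|f s| <= 1) -> `|Rintegral mu `[0, t] f| <= t.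
Proof.
move=> t0 cf f1.
have cfs : {within `[0, t], continuous f} by exact: continuous_subspaceT.
have fi : mu.-integrable `[0, t] (EFin \o f).
  by apply: continuous_compact_integrable => //; exact: segment_compact.
apply: le_trans (le_normr_Rintegral _ fi) _ => //.
have I1 : Rintegral mu `[0, t] (fun=> 1) = t.
  rewrite Rintegral_cst// mul1r /= lebesgue_measure_itv/= lte_fin t0/=.
  by rewrite subr0.
rewrite -[leRHS]I1; apply: le_Rintegral => //; last first.
  apply: continuous_compact_integrable; first exact: segment_compact.
  by apply: continuous_subspaceT => s; exact: cvg_cst.
exact: (integrable_abse fi).
Qed.

Lemma Rintegral_cos_sin (t x : R) : 0 < t ->
  Rintegral mu `[0, t] (fun s => cos (s * x)) ^+ 2 +
  Rintegral mu `[0, t] (fun s => sin (s * x)) ^+ 2 = fejer t x.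
Proof.
move=> t0; rewrite /fejer; case: ifPn => [/eqP ->|x0].
  under eq_Rintegral do rewrite mulr0 cos0.
  under [X in _ + X ^+ 2]eq_Rintegral do rewrite mulr0 sin0.
  rewrite !Rintegral_cst//= lebesgue_measure_itv/= lte_fin t0/=.
  by rewrite subr0 mul0r mul1r expr0n addr0.
rewrite (Rintegral_FTC2 t0 (@continuous_affine_cos x)
  (fun s => is_derive_affine_sin s x0)).
rewrite (Rintegral_FTC2 t0 (@continuous_affine_sin x)
  (fun s => is_derive_affine_cos s x0)).
rewrite mul0r sin0 cos0 mulr0 subr0 mulr1 opprK.
have := cos2Dsin2 (t * x); set c := cos _; set s := sin _ => cs.
rewrite (_ : _ + _ = (s ^+ 2 + c ^+ 2 + 1 - 2 * c) / x ^+ 2); last by field.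
by congr (_ / _); rewrite (addrC (s ^+ 2)) cs; ring.
Qed.

(** Both the cosine and the sine integral are at most t in absolute value; the
    sharp constant is 1, but any bound near 0 suffices for integrability. *)
Lemma fejer_bound t x : 0 < t -> fejer t x <= 2 * t ^+ 2.
Proof.
move=> t0; rewrite -Rintegral_cos_sin//.
have c1 := Rintegral_itv_le t0 (@continuous_affine_cos x) (fun s => cos_max (s * x)).
have s1 := Rintegral_itv_le t0 (@continuous_affine_sin x) (fun s => sin_max (s * x)).
rewrite -[in leLHS]real_normK ?num_real// -[X in _ + X <= _]real_normK ?num_real//.
by rewrite [leRHS](mulrDl 1 1) !mul1r lerD// ler_sqr ?nnegrE// ltW.
Qed.

Lemma fejer_le_oneDsqr t x : 0 < t ->
  fejer t x <= (2 * t ^+ 2 + 4) * (oneDsqr x)^-1.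
Proof.
move=> t0; rewrite -ler_pdivrMr ?invr_gt0 ?oneDsqr_gt0// invrK /oneDsqr.
rewrite mulrDr mulr1 lerD ?fejer_bound//.
have [->|x0] := eqVneq x 0; first by rewrite expr0n mulr0.
by rewrite -ler_pdivlMr ?exprn_even_gt0// fejer_le.
Qed.

Lemma integral_fejer_lty t : 0 < t -> (\int[mu]_x (fejer t x)%:E < +oo)%E.
Proof.
move=> t0.
have mo : measurable_fun [set: R] (fun x : R => ((@oneDsqr R x)^-1)%:E).
  apply/measurable_EFinP; apply: continuous_measurable_fun.
  exact: continuous_oneDsqrV.
apply: (@le_lt_trans _ _ (\int[mu]_x ((2 * t ^+ 2 + 4)%:E * ((oneDsqr x)^-1)%:E))%E).
  apply: ge0_le_integral => //.
  - by move=> x _; rewrite lee_fin fejer_ge0.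
  - by apply/measurable_EFinP; exact: measurable_fejer.
  - exact: measurable_funeM.
  - by move=> x _; rewrite -EFinM lee_fin fejer_le_oneDsqr.
have C0 : 0 <= 2 * t ^+ 2 + 4 by rewrite addr_ge0// mulr_ge0// sqr_ge0.
rewrite ge0_integralZl_EFin//.
rewrite ge0_symfun_integralT//; last 2 first.
- exact: continuous_oneDsqrV.
- by move=> x; rewrite /= /oneDsqr sqrrN.
rewrite (_ : [set x | _] = `[0, +oo[%classic); last first.
  by apply/seteqP; split => x /=; rewrite in_itv/= andbT.
by rewrite integral0y_oneDsqr -!EFinM ltry.
Qed.

Lemma integral_fejer_scale t : 0 < t ->
  (\int[mu]_x (fejer t x)%:E = t%:E * \int[mu]_x (fejer 1 x)%:E)%E.
Proof.
move=> t0.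
have m1 : measurable_fun [set: R] (fun x : R => (fejer 1 x)%:E).
  by apply/measurable_EFinP; exact: measurable_fejer.
rewrite (@integral_affine R t 0 (fun x => (fejer 1 x)%:E))//; last first.
  by move=> x; rewrite lee_fin fejer_ge0.
rewrite muleA -EFinM -ge0_integralZl_EFin ?mulr_ge0 ?ltW//; last 2 first.
- by move=> x _; rewrite lee_fin fejer_ge0.
- apply/measurable_EFinP; apply: measurableT_comp; first exact: measurable_fejer.
  by apply: measurable_funD => //; exact: measurable_funM.
by apply: eq_integral => x _; rewrite fejer_scale// addr0 expr2.
Qed.

Lemma integral_fejer_gt0 : (0 < \int[mu]_x (fejer 1 x)%:E)%E.
Proof.
have m1 : measurable_fun [set: R] (fun x : R => (fejer 1 x)%:E).
  by apply/measurable_EFinP; exact: measurable_fejer.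
apply: (@lt_le_trans _ _ (\int[mu]_(x in `]1%R, 2%R[) (fejer 1 x)%:E)%E); last first.
  apply: ge0_subset_integral => //.
  by move=> x _; rewrite lee_fin fejer_ge0.
apply: integral_gt0 => //.
- exact: measurable_funTS.
- move=> x /=; rewrite in_itv/= => /andP[x1 x2].
  have x0 : 0 < x by rewrite (lt_trans _ x1).
  rewrite lte_fin /fejer gt_eqF// divr_gt0 ?exprn_gt0// mul1r.
  have s0 : 0 < sin x by rewrite sin_gt0_pi// x0 (lt_le_trans x2)// pi_ge2.
  have := cos2Dsin2 x; have := exprn_gt0 2 s0; nra.
- by rewrite /= lebesgue_measure_itv/= lte_fin ltr1n -EFinD lte_fin; lra.
Qed.

End fejer_kernel.

(** * Euclidean balls and spheres *)

Section euclidean_norm.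
Context {R : realType} (d : nat).
Implicit Types v : vecR R d.

Lemma dotv_ge0 v : 0 <= dotv v v.
Proof. by apply: sumr_ge0 => i _; rewrite -expr2 sqr_ge0. Qed.

Lemma enorm_ge0 v : 0 <= enorm v.
Proof. exact: sqrtr_ge0. Qed.

Lemma sqr_enorm v : enorm v ^+ 2 = dotv v v.
Proof. by rewrite sqr_sqrtr// dotv_ge0. Qed.

Lemma norm_tnth_enorm v i : `|tnth v i : R| <= enorm v.
Proof.
rewrite -(@ler_pXn2r _ 2) ?nnegrE ?enorm_ge0// sqr_enorm real_normK ?num_real//.
rewrite /dotv (bigD1 i)//= -expr2 lerDl.
by apply: sumr_ge0 => j _; rewrite -expr2 sqr_ge0.
Qed.

Lemma enorm_scalev r v : 0 <= r -> enorm (scalev r v) = r * enorm v.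
Proof.
move=> r0; rewrite /enorm -[r in RHS](ger0_norm r0) -sqrtr_sqr -sqrtrM ?sqr_ge0//.
congr Num.sqrt; rewrite /dotv mulr_sumr; apply: eq_bigr => i _.
by rewrite tnth_mktuple; ring.
Qed.

Lemma measurable_enorm : measurable_fun setT (@enorm R d).
Proof.
apply: (measurableT_comp (continuous_measurable_fun (@sqrt_continuous R))).
apply: measurable_sum => i.
by apply: measurable_funM; exact: measurable_tnth.
Qed.

Lemma measurable_ball_enorm (r : R) : measurable [set v : vecR R d | enorm v <= r].
Proof.
have := measurable_enorm measurableT (measurable_itv `]-oo, r]).
by rewrite setTI; congr measurable.
Qed.

Lemma lebesgue_ball_lty (r : R) :
  (lebesgue_vec R d [set v | (enorm v <= r)%R] < +oo)%E.
Proof.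
apply: (@le_lt_trans _ _
    (lebesgue_vec R d [set v | forall i, `[- r, r]%classic (tnth v i)])).
  apply: le_measure; rewrite ?inE.
  - exact: measurable_ball_enorm.
  - rewrite [X in measurable X](_ : _ =
      \bigcap_(i in [set: 'I_d]) ((@tnth d _ ^~ i) @^-1` `[- r, r]%classic)).
      apply: fin_bigcap_measurable => // i _.
      rewrite -[X in measurable X]setTI; exact: measurable_tnth.
    by apply/seteqP; split => v /= Av i; [move=> _|]; exact: Av.
  - move=> v /= vr i; rewrite in_itv/= -ler_norml.
    exact: le_trans (norm_tnth_enorm v i) vr.
rewrite (@lebesgue_vec_box R d (fun=> `[- r, r]%classic))//.
have [m0 mlty] : (0 <= @lebesgue_measure R `[(- r)%R, r] /\
    @lebesgue_measure R `[(- r)%R, r] < +oo)%E.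
  split; first exact: measure_ge0.
  by rewrite /= lebesgue_measure_itv/=; case: ifPn => _; rewrite ?ltry// -EFinD ltry.
rewrite -ge0_fin_numE ?prode_fin_num// => [i _|].
  by rewrite ge0_fin_numE.
by elim/big_ind : _ => //; exact: mule_ge0.
Qed.

Lemma lebesgue_ball_scale (r s : R) : 0 < r ->
  (lebesgue_vec R d [set v | (enorm v <= r * s)%R] =
  (r ^+ d)%:E * lebesgue_vec R d [set v | (enorm v <= s)%R])%E.
Proof.
move=> r0.
have ballE b : lebesgue_vec R d [set v | enorm v <= b] =
    (\int[lebesgue_vec R d]_v (\1_[set v : vecR R d | (enorm v <= b)%R] v)%:E)%E.
  by rewrite integral_indic ?setIT//; exact: measurable_ball_enorm.
rewrite !ballE (@integral_lebesgue_vec_scale _ _ r)//; last first.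
  by apply/measurable_EFinP/measurable_indic; exact: measurable_ball_enorm.
congr (_ * _)%E; apply: eq_integral => v _; rewrite !indicE.
congr (_%:R%:E); congr nat_of_bool.
by apply/idP/idP; rewrite !inE/= (enorm_scalev _ (ltW r0)) (ler_pM2l r0).
Qed.

(** For q < 1 the sphere lies in the ball of radius r and outside that of radius
    q r, whose measure is q^d times as large; let q tend to 1. *)
Lemma lebesgue_sphere0 (r : R) : 0 < r ->
  (lebesgue_vec R d [set v | enorm v = r] = 0)%E.
Proof.
move=> r0; pose B (s : R) : set (vecR R d) := [set v | enorm v <= s].
have mB s : measurable (B s) by exact: measurable_ball_enorm.
have mS : measurable [set v : vecR R d | enorm v = r].
  have := measurable_enorm measurableT (measurable_set1 r).
  by rewrite setTI.
set m := (lebesgue_vec R d _).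
have Bf : lebesgue_vec R d (B r) \is a fin_num.
  by rewrite ge0_fin_numE//; exact: lebesgue_ball_lty.
have mf : m \is a fin_num.
  rewrite ge0_fin_numE ?measure_ge0//; apply: (@le_lt_trans _ _ (lebesgue_vec R d (B r))).
    apply: le_measure; rewrite ?inE; [exact: mS|exact: mB|].
    by rewrite /B => v /= ->.
  exact: lebesgue_ball_lty.
have key (q : R) : 0 < q < 1 -> fine m <= (1 - q ^+ d) * fine (lebesgue_vec R d (B r)).
  move=> /andP[q0 q1].
  have : (lebesgue_vec R d ([set v | enorm v = r] `|` B (q * r)%R) <=
      lebesgue_vec R d (B r))%E.
    apply: le_measure; rewrite ?inE; [exact: measurableU|exact: mB|].
    rewrite /B => v [/= ->//|/= /le_trans]; apply.
    by rewrite ler_piMl// ltW.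
  rewrite measureU//; last first.
    rewrite /B; apply/seteqP; split => // v /= [->].
    by rewrite leNgt gtr_pMl// q1.
  move=> h.
  have {h} : (m + lebesgue_vec R d (B (q * r)%R) <= lebesgue_vec R d (B r))%E := h.
  have -> : (lebesgue_vec R d (B (q * r)%R) = (q ^+ d)%:E * lebesgue_vec R d (B r))%E.
    exact: lebesgue_ball_scale.
  rewrite -(fineK mf) -(fineK Bf) -EFinM -EFinD lee_fin.
  by rewrite mulrBl mul1r lerBrDr.
have lim :
    (1 - (1 - n.+1%:R^-1) ^+ d) * fine (lebesgue_vec R d (B r)) @[n --> \oo] -->
    ((1 - (1 - 0) ^+ d) * fine (lebesgue_vec R d (B r)) : R).
  apply: cvgM; last exact: cvg_cst.
  apply: (@cvgB _ R^o); first exact: cvg_cst.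
  apply: (@cvg_comp _ _ _ (fun n : nat => 1 - n.+1%:R^-1 : R) (fun x => x ^+ d));
    last exact: exprn_continuous.
  by apply: (@cvgB _ R^o); [exact: cvg_cst|exact: cvg_harmonic].
have m0 : fine m <= 0.
  move: lim; rewrite subr0 expr1n subrr mul0r => lim.
  rewrite -[leRHS](cvg_lim _ lim)//.
  apply: limr_ge; first by apply/cvg_ex; eexists; exact: lim.
  near=> n; apply: key.
  have n1 : (1 < n)%N by near: n; exact: nbhs_infty_gt.
  rewrite subr_gt0 invf_lt1// ltr1n ltnS (ltnW n1)/=.
  by rewrite ltrBlDr ltrDl invr_gt0.
rewrite -(fineK mf); congr EFin; apply/eqP.
by rewrite eq_le m0/=; apply: fine_ge0; exact: measure_ge0.
Unshelve. all: by end_near. Qed.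

End euclidean_norm.

(** * Parabolic scaling of the spectral density *)

Section product_substitution.
Context {R : realType}.
Local Notation mu := (@lebesgue_measure R).

(** One substitution for two purposes: with g = 0 it dilates the first variable,
    with g = |eta|^2 it straightens the paraboloid xi = |eta|^2. *)
Lemma integral_prod_shear d2 (T2 : measurableType d2)
    (m2 : {sigma_finite_measure set T2 -> \bar R}) (a : R) (g : T2 -> R)
    (F : measurableTypeR R * T2 -> \bar R) :
  0 < a -> measurable_fun setT g -> measurable_fun setT F ->
  (forall p, 0 <= F p)%E ->
  (\int[mu \x m2]_p F p =
   a%:E * \int[mu \x m2]_p F ((a * p.1 + g p.2)%R, p.2))%E.
Proof.
move=> a0 mg mF F0.
have mF' : measurable_fun setT
    (fun p : measurableTypeR R * T2 => F ((a * p.1 + g p.2 : R), p.2)).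
  apply: (measurableT_comp mF); apply/measurable_fun_pairP; split => /=.
    apply: measurable_funD; last exact: measurableT_comp mg measurable_snd.
    by apply: measurable_funM => //; exact: measurable_fst.
  exact: measurable_snd.
rewrite fubini_tonelli2// [in RHS]fubini_tonelli2// /fubini_G.
rewrite -ge0_integralZl_EFin ?ltW//; last 2 first.
- by move=> y _; apply: integral_ge0.
- exact: (measurable_fun_fubini_tonelli_G (m1 := mu) _ mF' (fun=> F0 _)).
apply: eq_integral => y _ /=.
apply: (integral_affine (f := fun x => F (x, y)) (g y) a0) => //.
exact: measurableT_comp mF (measurable_pair2 y).
Qed.

Lemma integral_prod_scalev d1 (T1 : measurableType d1)
    (m1 : {sigma_finite_measure set T1 -> \bar R}) n (r : R)
    (F : T1 * vecR R n -> \bar R) :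
  0 < r -> measurable_fun setT F -> (forall p, 0 <= F p)%E ->
  (\int[m1 \x lebesgue_vec R n]_p F p =
   (r ^+ n)%:E * \int[m1 \x lebesgue_vec R n]_p F (p.1, scalev r p.2))%E.
Proof.
move=> r0 mF F0.
have mF' : measurable_fun setT (fun p : T1 * vecR R n => F (p.1, scalev r p.2)).
  apply: (measurableT_comp mF); apply/measurable_fun_pairP; split => /=.
    exact: measurable_fst.
  exact: measurableT_comp (@measurable_scalev R n r) measurable_snd.
rewrite fubini_tonelli1// [in RHS]fubini_tonelli1// /fubini_F.
rewrite -ge0_integralZl_EFin ?exprn_ge0 ?ltW//; last 2 first.
- by move=> y _; apply: integral_ge0.
- exact: (measurable_fun_fubini_tonelli_F (m2 := lebesgue_vec R n) _ mF' (fun=> F0 _)).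
apply: eq_integral => y _ /=.
apply: (integral_lebesgue_vec_scale (f := fun v => F (y, v)) r0) => //.
exact: measurableT_comp mF (measurable_pair1 y).
Qed.

Lemma integral_parabolic_scaling n (r : R)
    (F : measurableTypeR R * vecR R n -> \bar R) :
  0 < r -> measurable_fun setT F -> (forall p, 0 <= F p)%E ->
  (\int[lebesgue_spacetime n]_p F p =
   (r ^+ 2 * r ^+ n)%:E *
   \int[lebesgue_spacetime n]_p F ((r ^+ 2 * p.1)%R, scalev r p.2))%E.
Proof.
move=> r0 mF F0; rewrite /lebesgue_spacetime.
have m0 : measurable_fun [set: vecR R n] (cst (0 : R)) by [].
rewrite (integral_prod_shear _ (exprn_gt0 2 r0) m0 mF F0).
rewrite (EFinM (r ^+ 2) (r ^+ n)) -muleA; congr (_ * _)%E.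
under eq_integral do rewrite addr0.
rewrite (integral_prod_scalev _ r0)//.
apply: (measurableT_comp mF); apply/measurable_fun_pairP; split => /=.
  by apply: measurable_funM => //; exact: measurable_fst.
exact: measurable_snd.
Qed.

End product_substitution.

Section spectral_density.
Context {R : realType} (d : nat) (H : 'I_d.+1 -> R).
Context (hH : forall i, 0 < H i < 1).
Local Notation mu := (@lebesgue_measure R).

Definition space_weight (v : vecR R d) : R :=
  \prod_(i < d) (`|tnth v i : R| `^ (2 * H (lift ord0 i) - 1))^-1.

Lemma spectral_densityE p :
  spectral_density H p = (`|p.1 : R| `^ (2 * H ord0 - 1))^-1 * space_weight p.2.
Proof. by []. Qed.

Lemma space_weight_ge0 v : 0 <= space_weight v.
Proof. by apply: prodr_ge0 => i _; rewrite invr_ge0 powR_ge0. Qed.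

Lemma spectral_density_ge0 p : 0 <= spectral_density H p.
Proof. by rewrite mulr_ge0 ?invr_ge0 ?powR_ge0 ?space_weight_ge0. Qed.

Lemma measurable_norm_powRV (e : R) :
  measurable_fun [set: R] (fun x : R => (`|x| `^ e)^-1).
Proof.
under eq_fun do rewrite -powRN.
exact: measurable_norm_powR.
Qed.

Lemma measurable_space_weight : measurable_fun setT space_weight.
Proof.
apply: measurable_prod => i _.
exact: measurableT_comp (@measurable_norm_powRV _) (@measurable_tnth _ _ d i).
Qed.

Lemma measurable_spectral_density : measurable_fun setT (spectral_density H).
Proof.
apply: measurable_funM.
  exact: measurableT_comp (@measurable_norm_powRV _) measurable_fst.
exact: measurableT_comp measurable_space_weight measurable_snd.
Qed.

Lemma integral_hurst_weight_lty i (b : R) : 0 < b ->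
  (\int[mu]_x (\1_[set x : R | (`|x| <= b)%R] x * (`|x| `^ (2 * H i - 1))^-1)%:E
    < +oo)%E.
Proof.
move=> b0; rewrite -integral_indicE.
under eq_integral do rewrite -powRN.
apply: integral_norm_powR_lty => //.
by have /andP[] := hH i; lra.
Qed.

Lemma measurable_hurst_weight i (b : R) : measurable_fun setT
  (fun x : R => \1_[set x : R | `|x| <= b] x * (`|x| `^ (2 * H i - 1))^-1).
Proof.
apply: measurable_funM; last exact: measurable_norm_powRV.
by apply: measurable_indic; exact: measurable_norm_le.
Qed.

Lemma integral_space_weight_lty (b : R) : 0 < b ->
  (\int[lebesgue_vec R d]_v
     (\1_[set v : vecR R d | (enorm v <= b)%R] v * space_weight v)%:E < +oo)%E.
Proof.
move=> b0.
pose g (i : 'I_d) (x : R) :=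
  \1_[set x : R | (`|x| <= b)%R] x * (`|x| `^ (2 * H (lift ord0 i) - 1))^-1.
have mg i : measurable_fun setT (g i) by exact: measurable_hurst_weight.
have g0 i x : 0 <= g i x by rewrite mulr_ge0// invr_ge0 powR_ge0.
apply: (@le_lt_trans _ _
    (\int[lebesgue_vec R d]_v (\prod_(i < d) g i (tnth v i))%:E)%E).
  apply: ge0_le_integral => //.
  - by move=> v _; rewrite lee_fin mulr_ge0// space_weight_ge0.
  - apply/measurable_EFinP; apply: measurable_funM; last exact: measurable_space_weight.
    by apply: measurable_indic; exact: measurable_ball_enorm.
  - apply/measurable_EFinP; apply: measurable_prod => i _.
    exact: measurableT_comp (mg i) (@measurable_tnth _ _ d i).
  - move=> v _; rewrite lee_fin; have [vb|vb] := leP (enorm v) b; last first.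
      rewrite indicE memNset/= ?mul0r; first exact: prodr_ge0.
      by apply/negP; rewrite -ltNge.
    rewrite indicE mem_set//= mul1r le_eqVlt; apply/orP; left; apply/eqP/eq_bigr => i _.
    rewrite /g indicE mem_set ?mul1r//=.
    exact: le_trans (norm_tnth_enorm v i) vb.
rewrite integral_lebesgue_vec_prod//.
have h (i : 'I_d) : (0 <= \int[mu]_x (g i x)%:E < +oo)%E.
  rewrite integral_hurst_weight_lty// andbT; apply: integral_ge0 => x _.
  by rewrite lee_fin.
rewrite -ge0_fin_numE ?prode_fin_num// => [i _|].
  by rewrite ge0_fin_numE; have /andP[] := h i.
by elim/big_ind : _ => // [|i _]; [exact: mule_ge0|have /andP[] := h i].
Qed.

(** All the exponents 1 - 2 H_i exceed -1. *)
Lemma integral_spectral_density_lty (a b : R) : 0 < a -> 0 < b ->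
  (\int[lebesgue_spacetime d]_(p in [set p | (`|p.1 : R| <= a)%R /\ (enorm p.2 <= b)%R])
     (spectral_density H p)%:E < +oo)%E.
Proof.
move=> a0 b0; rewrite integral_indicE.
pose f (x : measurableTypeR R) : R :=
  \1_[set x : R | (`|x| <= a)%R] x * (`|x : R| `^ (2 * H ord0 - 1))^-1.
pose g (v : vecR R d) : R :=
  \1_[set v : vecR R d | (enorm v <= b)%R] v * space_weight v.
rewrite (eq_integral (fun p => (f p.1 * g p.2)%:E)); last first.
  move=> p _; congr EFin; rewrite spectral_densityE /f /g mulrACA; congr (_ * _).
  rewrite !indicE -natrM mulnb; congr (_%:R); congr nat_of_bool.
  by apply/idP/andP; rewrite !inE.
rewrite /lebesgue_spacetime integral_prod_mul; last 4 first.
- exact: measurable_hurst_weight.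
- apply: measurable_funM; last exact: measurable_space_weight.
  by apply: measurable_indic; exact: measurable_ball_enorm.
- by move=> x; rewrite mulr_ge0// invr_ge0 powR_ge0.
- by move=> v; rewrite mulr_ge0// space_weight_ge0.
apply: lte_mul_pinfty; last exact: integral_space_weight_lty.
- by apply: integral_ge0 => x _; rewrite lee_fin mulr_ge0// invr_ge0 powR_ge0.
- rewrite ge0_fin_numE; first exact: integral_hurst_weight_lty.
  by apply: integral_ge0 => x _; rewrite lee_fin mulr_ge0// invr_ge0 powR_ge0.
Qed.

Lemma prodr_powR (I : finType) (r : R) (a : I -> R) : 0 < r ->
  \prod_i r `^ (a i) = r `^ (\sum_i a i).
Proof.
move=> r0; elim/big_rec2 : _ => [|i x y _ ->]; first by rewrite powRr0.
by rewrite powRD// (gt_eqF r0) implybT.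
Qed.

Lemma space_weight_scale r v : 0 < r ->
  space_weight (scalev r v) =
  r `^ (\sum_(i < d) (1 - 2 * H (lift ord0 i))) * space_weight v.
Proof.
move=> r0; rewrite /space_weight -prodr_powR// -big_split/=; apply: eq_bigr => i _.
rewrite tnth_mktuple normrM (gtr0_norm r0) (powRM _ (ltW r0) (normr_ge0 _)).
rewrite invfM -[X in X * _ = _]powRN.
by congr (_ `^ _ * _); ring.
Qed.

(** The factor r ^+ d is the Jacobian of the space dilation.  The Jacobian r ^+ 2
    of the time dilation is left aside: it goes with the Fejer kernel, where it
    is the normalisation of an approximate identity. *)
Lemma spectral_density_scale r p : 0 < r ->
  r ^+ d * spectral_density H ((r ^+ 2 * p.1)%R, scalev r p.2) =
  r `^ (2 * (d.+1%:R - hurst_sum H)) * spectral_density H p.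
Proof.
move=> r0; rewrite !spectral_densityE/= space_weight_scale// normrM.
have r20 : 0 < r ^+ 2 by rewrite exprn_gt0.
rewrite (gtr0_norm r20) (powRM _ (ltW r20) (normr_ge0 _)) invfM.
rewrite -[X in _ * (X * _ * _) = _]powRN -(powR_mulrn 2 (ltW r0)) -powRrM.
rewrite -(powR_mulrn d (ltW r0)).
set A := _ `^ d%:R; set B := _ `^ (2%:R * _); set C := _ `^ (\sum_(i < d) _).
have -> : r `^ (2 * (d.+1%:R - hurst_sum H)) = A * B * C.
  rewrite /A /B /C -!powRD ?(gt_eqF r0) ?implybT//; congr (_ `^ _).
  rewrite sumrB -mulr_sumr sumr_const card_ord /hurst_sum -natr1.
  by ring.
by ring.
Qed.

End spectral_density.

(** * The energy of a shell *)

(** Away from 0 and infinity the time weight is harmless whatever the sign of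
    its exponent. *)
Lemma invr_powR_le4 (R : realType) (a x : R) : -1 < a < 1 -> 1 / 3 <= x <= 4 ->
  (x `^ a)^-1 <= 4.
Proof.
move=> /andP[a0 a1] /andP[x3 x4].
have x0 : 0 < x by lra.
rewrite -powRN; have [x1|x1] := leP 1 x.
  apply: (le_trans _ x4); rewrite -[leRHS](powRr1 (ltW x0)).
  by apply: ler_powR => //; lra.
have : x `^ (- a) <= x `^ (-1) by apply: ger_powR; lra.
rewrite (powR_inv1 (ltW x0)) => /le_trans; apply.
rewrite -[leRHS]invrK lef_pV2 ?posrE ?invr_gt0//; lra.
Qed.

Lemma continuous_powR_gt0 (R : realType) (a x : R) : 0 < x ->
  {for x, continuous (fun y : R => y `^ a)}.
Proof.
move=> x0; apply: differentiable_continuous; apply/derivable1_diffP.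
by apply: derivable_powR; rewrite in_itv/= x0.
Qed.

Section shell.
Context {R : realType} (d : nat) (H : 'I_d.+1 -> R).
Context (hH : forall i, 0 < H i < 1).
Local Notation mu := (@lebesgue_measure R).
Local Notation space := (measurableTypeR R * vecR R d)%type.
Implicit Types (p : space) (v : vecR R d).

Lemma measurable_freq_domain n : measurable (@freq_domain R d n).
Proof.
rewrite (_ : freq_domain n =
   [set x : R | `|x| <= 2 ^+ (2 * n)] `*` [set v : vecR R d | enorm v <= 2 ^+ n]).
  by apply: measurableX; [exact: measurable_norm_le|exact: measurable_ball_enorm].
by apply/seteqP; split => -[].
Qed.

Definition unit_shell : set space := freq_domain 1 `\` freq_domain 0.

Lemma unit_shellP p : unit_shell p <->
  [/\ `|p.1 : R| <= 4, enorm p.2 <= 2 & (1 < `|p.1 : R|) || (1 < enorm p.2)].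
Proof.
have e4 : 2 ^+ (2 * 1) = 4 :> R by rewrite muln1 -natrX.
rewrite /unit_shell /freq_domain/= muln0 !expr0 expr1 e4; split.
  move=> [[-> ->] h]; split => //; rewrite !ltNge -negb_and.
  by apply/negP => /andP[h1 h2]; exact: h.
by move=> [-> -> h]; split => // -[]; rewrite !leNgt; case/orP: h => ->.
Qed.

Lemma measurable_unit_shell : measurable unit_shell.
Proof. by apply: measurableD; exact: measurable_freq_domain. Qed.

(** The signed distance, in the time frequency, to the paraboloid
    xi = |eta|^2 on which the kernel concentrates. *)
Definition offset p : R := enorm p.2 ^+ 2 - p.1.

Lemma measurable_offset : measurable_fun setT offset.
Proof.
apply: measurable_funB; last exact: measurable_fst.
apply: measurable_funX.
exact: measurableT_comp (@measurable_enorm R d) measurable_snd.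
Qed.

(** With the threshold 1/3, resonance on the shell forces xi > 1/3: it gives
    xi > |eta|^2 - 1/3, so xi > 2/3 if |eta| > 1, and xi > -1/3 settles the sign
    of xi if |xi| > 1. *)
Definition resonant : set space := [set p | `|offset p| < 1 / 3].

Lemma measurable_resonant : measurable resonant.
Proof.
have := measurableT_comp (@normr_measurable R setT) measurable_offset.
move=> /(_ measurableT _ (measurable_itv `]-oo, 1 / 3[)).
by rewrite setTI.
Qed.

(** The density against 4^n K_t(4^n .), an approximate identity up to mass. *)
Definition rescaled_density (t : R) (n : nat) p : R :=
  4 ^+ n * (spectral_density H p * fejer t (4 ^+ n * offset p)).

Lemma rescaled_density_ge0 t n p : 0 <= rescaled_density t n p.
Proof.
apply: mulr_ge0; first exact: exprn_ge0.
by apply: mulr_ge0; [exact: spectral_density_ge0|exact: fejer_ge0].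
Qed.

Lemma measurable_rescaled_density t n : measurable_fun setT (rescaled_density t n).
Proof.
apply: measurable_funM => //; apply: measurable_funM.
  exact: measurable_spectral_density.
apply: measurableT_comp; first exact: measurable_fejer.
by apply: measurable_funM => //; exact: measurable_offset.
Qed.

(** Off resonance the rescaled kernel is at most 36 / 4^n, and the density is
    integrable on the bounded shell. *)
Lemma far_shell_cvg (t : R) :
  (\int[lebesgue_spacetime d]_(p in unit_shell `\` resonant)
     (rescaled_density t n p)%:E)%E @[n --> \oo] --> 0%E.
Proof.
pose B : set space := [set p | (`|p.1 : R| <= 4)%R /\ (enorm p.2 <= 2)%R].
have mB : measurable B.
  rewrite (_ : B = [set x : R | `|x| <= 4] `*` [set v : vecR R d | enorm v <= 2]).
    by apply: measurableX; [exact: measurable_norm_le|exact: measurable_ball_enorm].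
  by apply/seteqP; split => -[].
have mdens : measurable_fun setT (fun p : space => (spectral_density H p)%:E).
  by apply/measurable_EFinP; exact: measurable_spectral_density.
have mS : measurable (unit_shell `\` resonant).
  by apply: measurableD; [exact: measurable_unit_shell|exact: measurable_resonant].
pose C := (\int[lebesgue_spacetime d]_(p in B) (spectral_density H p)%:E)%E.
have C0 : (0 <= C)%E.
  by apply: integral_ge0 => p _; rewrite lee_fin spectral_density_ge0.
have Cfin : C \is a fin_num.
  by rewrite ge0_fin_numE//; exact: integral_spectral_density_lty.
have key (N o : R) : 0 < N -> 1 / 3 <= `|o| -> N * (4 / (N * o) ^+ 2) <= 36 / N.
  move=> N0 o3; have o0 : o != 0 by rewrite -normr_gt0; lra.
  have -> : N * (4 / (N * o) ^+ 2) = 4 / o ^+ 2 / N by field; rewrite o0 gt_eqF.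
  rewrite ler_pM2r ?invr_gt0// ler_pdivrMr ?exprn_even_gt0// -real_normK ?num_real//.
  by nra.
apply: (@squeeze_cvge _ _ _ _ (cst 0%E) _ (fun n => (36 * fine C * 4^-1 ^+ n)%:E)).
- apply: nearW => n; apply/andP; split.
    by apply: integral_ge0 => p _; rewrite lee_fin rescaled_density_ge0.
  apply: (@le_trans _ _ (\int[lebesgue_spacetime d]_(p in unit_shell `\` resonant)
      ((36 * 4^-1 ^+ n)%:E * (spectral_density H p)%:E))%E).
    apply: ge0_le_integral => //.
    - by move=> p _; rewrite lee_fin rescaled_density_ge0.
    - apply: measurable_funTS; apply/measurable_EFinP.
      exact: measurable_rescaled_density.
    - by apply: measurable_funTS; exact: measurable_funeM.
    - move=> p [_] /negP; rewrite -leNgt => hp.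
      rewrite -EFinM lee_fin /rescaled_density mulrCA [leRHS]mulrC.
      rewrite ler_wpM2l ?spectral_density_ge0//.
      have N0 : 0 < 4 ^+ n :> R by rewrite exprn_gt0.
      have o0 : offset p != 0.
        by apply/eqP => o0; move: hp; rewrite o0 normr0; lra.
      apply: (@le_trans _ _ (4 ^+ n * (4 / (4 ^+ n * offset p) ^+ 2))).
        by rewrite ler_pM2l// fejer_le// mulf_neq0// gt_eqF.
      rewrite exprVn; exact: key.
  rewrite ge0_integralZl_EFin//; last 2 first.
  - by move=> p _; rewrite lee_fin spectral_density_ge0.
  - exact: measurable_funTS.
  rewrite [in leRHS]mulrAC [leRHS]EFinM (fineK Cfin); apply: lee_wpmul2l.
    by rewrite lee_fin mulr_ge0 ?exprn_ge0 ?invr_ge0.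
  apply: ge0_subset_integral => //.
  - exact: measurable_funTS.
  - by move=> p _; rewrite lee_fin spectral_density_ge0.
  - by move=> p [/unit_shellP[]].
- exact: cvg_cst.
- apply: cvg_EFin; first exact: nearW.
  by apply: cvg_geometric; rewrite ger0_norm ?invr_ge0// invf_lt1// ltr1n.
Qed.

Definition shell_weight v : R :=
  \1_[set v : vecR R d | 1 < enorm v <= 2] v *
  (space_weight H v * ((enorm v ^+ 2) `^ (2 * H ord0 - 1))^-1).

(** The integral of the density along the paraboloid xi = |eta|^2 over the
    annulus cut out by the shell. *)
Definition shell_constant : \bar R :=
  (\int[lebesgue_vec R d]_v (shell_weight v)%:E)%E.

Lemma shell_weight_ge0 v : 0 <= shell_weight v.
Proof.
apply: mulr_ge0 => //; apply: mulr_ge0; first exact: space_weight_ge0.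
by rewrite invr_ge0 powR_ge0.
Qed.

Lemma measurable_annulus (a b : R) :
  measurable [set v : vecR R d | a < enorm v <= b].
Proof.
have := @measurable_enorm R d measurableT _ (measurable_itv `]a, b]).
by rewrite setTI.
Qed.

Lemma measurable_shell_weight : measurable_fun setT shell_weight.
Proof.
apply: measurable_funM.
  by apply: measurable_indic; exact: measurable_annulus.
apply: measurable_funM; first exact: measurable_space_weight.
under eq_fun do rewrite -powRN.
apply: (measurableT_comp (measurable_powR _)).
by apply: measurable_funX; exact: measurable_enorm.
Qed.

(** The substitution xi = |eta|^2 + y / 4^n, after which the rescaled kernel
    becomes K_t(y), independently of n. *)
Definition sheared (n : nat) p : space := ((4^-1 ^+ n * p.1 + enorm p.2 ^+ 2)%R, p.2).

Lemma measurable_sheared n : measurable_fun setT (sheared n).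
Proof.
apply/measurable_fun_pairP; split => /=; last exact: measurable_snd.
apply: measurable_funD.
  by apply: measurable_funM => //; exact: measurable_fst.
apply: measurable_funX.
exact: measurableT_comp (@measurable_enorm R d) measurable_snd.
Qed.

Definition near_density t n p : R :=
  \1_(unit_shell `&` resonant) (sheared n p) *
  (spectral_density H (sheared n p) * fejer t p.1).

Lemma near_shellE t n :
  (\int[lebesgue_spacetime d]_(p in unit_shell `&` resonant)
     (rescaled_density t n p)%:E =
   \int[lebesgue_spacetime d]_p (near_density t n p)%:E)%E.
Proof.
have mS : measurable (unit_shell `&` resonant).
  by apply: measurableI; [exact: measurable_unit_shell|exact: measurable_resonant].
have N0 : 0 < 4^-1 ^+ n :> R by rewrite exprn_gt0// invr_gt0.
have mF : measurable_fun setT (fun p : space =>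
    (\1_(unit_shell `&` resonant) p * rescaled_density t n p)%:E).
  apply/measurable_EFinP; apply: measurable_funM; first exact: measurable_indic.
  exact: measurable_rescaled_density.
have me : measurable_fun setT (fun v : vecR R d => enorm v ^+ 2).
  by apply: measurable_funX; exact: measurable_enorm.
rewrite integral_indicE /lebesgue_spacetime (integral_prod_shear _ N0 me mF); last first.
  by move=> p; rewrite lee_fin mulr_ge0// rescaled_density_ge0.
rewrite -ge0_integralZl_EFin ?ltW//; last 2 first.
- by move=> p _; rewrite lee_fin mulr_ge0// rescaled_density_ge0.
- exact: measurableT_comp mF (measurable_sheared n).
apply: eq_integral => p _; rewrite -EFinM; congr EFin.
rewrite -/(sheared n p) /near_density /rescaled_density.
rewrite (_ : 4 ^+ n * offset _ = - (p.1 : R)) ?fejerN; last first.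
  by rewrite /offset/= exprVn; field; rewrite expf_neq0// pnatr_eq0.
rewrite mulrCA; congr (_ * _).
by rewrite exprVn mulKf// expf_neq0// pnatr_eq0.
Qed.

Lemma near_density_ge0 t n p : 0 <= near_density t n p.
Proof.
apply: mulr_ge0 => //.
by apply: mulr_ge0; [exact: spectral_density_ge0|exact: fejer_ge0].
Qed.

Lemma measurable_near_density t n : measurable_fun setT (near_density t n).
Proof.
apply: measurable_funM.
  apply: (measurableT_comp _ (measurable_sheared n)); apply: measurable_indic.
  by apply: measurableI; [exact: measurable_unit_shell|exact: measurable_resonant].
apply: measurable_funM.
  exact: measurableT_comp (measurable_spectral_density H) (measurable_sheared n).
exact: measurableT_comp (measurable_fejer t) measurable_fst.
Qed.

Lemma near_density_le t n p : near_density t n p <=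
  fejer t p.1 * (4 * (\1_[set v : vecR R d | enorm v <= 2] p.2 * space_weight H p.2)).
Proof.
have [h|h] := pselect ((unit_shell `&` resonant) (sheared n p)); last first.
  rewrite /near_density indicE memNset// mul0r mulr_ge0 ?fejer_ge0//.
  by rewrite !mulr_ge0// space_weight_ge0.
rewrite /near_density [X in X * _]indicE mem_set// mul1r mulrC.
rewrite ler_wpM2l ?fejer_ge0// spectral_densityE.
move: h => [/unit_shellP[x4 v2 out] res].
rewrite indicE mem_set//= mul1r; apply: ler_wpM2r; first exact: space_weight_ge0.
move: res; rewrite /resonant/= /offset/= ltr_norml => /andP[r1 r2].
have x3 : 1 / 3 <= (sheared n p).1.
  move: out; rewrite ltr_normr /= => /orP[/orP[|]|v1].
  - by move=> x1; lra.
  - by have := sqr_ge0 (enorm p.2); lra.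
  - have v21 : 1 < enorm p.2 ^+ 2 by rewrite exprn_egt1.
    by lra.
apply: invr_powR_le4; first by have /andP[] := hH ord0; lra.
by rewrite (le_trans x3 (ler_norm _)) x4.
Qed.

(** The sheared point tends to (|eta|^2, eta).  This limit lies in the interior
    of the shell if 1 < |eta| < 2 and in the interior of its complement if
    |eta| < 1; if |eta| > 2 the integrand vanishes.  On the two remaining spheres
    membership in the shell may keep depending on the sign of y. *)
Lemma near_density_cvg t p : enorm p.2 != 1 -> enorm p.2 != 2 ->
  near_density t n p @[n --> \oo] --> fejer t p.1 * shell_weight p.2.
Proof.
move=> e1 e2; set u := enorm p.2 ^+ 2; pose x n := (sheared n p).1 : R.
have cx : x n @[n --> \oo] --> u.
  rewrite -[u]add0r; apply: (@cvgD _ R^o); last exact: cvg_cst.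
  under eq_fun do rewrite mulrC.
  by apply: cvg_geometric; rewrite ger0_norm ?invr_ge0// invf_lt1// ltr1n.
have [v1|v1|v1] := ltgtP (enorm p.2) 1; last by rewrite v1 eqxx in e1.
- (* Eventually |x n| < 1 as well, so the sheared point leaves the shell. *)
  have u1 : u < 1 by rewrite exprn_ilt1// enorm_ge0.
  have u0 : -1 < u by have := sqr_ge0 (enorm p.2); rewrite -/u; lra.
  rewrite /shell_weight indicE memNset/= ?mul0r ?mulr0; last first.
    by move=> /andP[v1' _]; move: (lt_trans v1 v1'); rewrite ltxx.
  apply: cvg_near_cst; near=> n.
  rewrite /near_density indicE memNset ?mul0r// => -[/unit_shellP[_ _ out] _].
  case/orP: out.
  + have : x n < 1 by near: n; apply: cvgr_lt cx _ u1.
    have : -1 < x n by near: n; apply: cvgr_gt cx _ u0.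
    rewrite -/(x n) ltr_normr => ? ? /orP[]; lra.
  + by rewrite ltNge (ltW v1).
- have [v2|v2|v2] := ltgtP (enorm p.2) 2; last by rewrite v2 eqxx in e2.
  + have u4 : u < 4.
      have -> : 4 = 2 ^+ 2 :> R by rewrite -natrX.
      by apply: ltrXn2r => //; exact: enorm_ge0.
    have u1 : 1 < u by rewrite exprn_egt1.
    have u0 : 0 < u by rewrite (lt_trans _ u1).
    rewrite /shell_weight indicE mem_set/= ?mul1r; last by rewrite v1 ltW.
    rewrite [fejer t p.1 * _]mulrC [space_weight H p.2 * _]mulrC.
    apply: (@cvg_trans _ ((`|x n| `^ (2 * H ord0 - 1))^-1 * space_weight H p.2 *
        fejer t p.1 @[n --> \oo])).
      apply: near_eq_cvg; near=> n.
      rewrite /near_density indicE mem_set ?mul1r//; split.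
      * apply/unit_shellP; split; rewrite ?v1 ?orbT ?(ltW v2)//.
        rewrite -/(x n) ger0_norm; first by near: n; apply: cvgr_le cx _ u4.
        by near: n; apply: cvgr_ge cx _ u0.
      * rewrite /resonant/= /offset/= -/(x n) -/u.
        by near: n; apply: cvgr_dist_lt cx _ _; lra.
    apply: cvgM; last exact: cvg_cst.
    apply: cvgM; last exact: cvg_cst.
    rewrite -/u -powRN -(gtr0_norm u0); under eq_fun do rewrite -powRN.
    apply: (@cvg_comp _ _ _ (fun n => `|x n|) (fun z => z `^ _) _ (nbhs `|u|)).
      exact: cvg_norm.
    by apply: continuous_powR_gt0; rewrite normr_gt0 gt_eqF.
  + rewrite /shell_weight indicE memNset/= ?mul0r ?mulr0; last first.
      by move=> /andP[_]; rewrite leNgt v2.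
    apply: cvg_near_cst; apply: nearW => n.
    rewrite /near_density indicE memNset ?mul0r// => -[/unit_shellP[_ + _] _].
    by rewrite /= leNgt v2.
Unshelve. all: by end_near. Qed.

(** Dominated convergence in both variables at once, with the dominating
    function 4 K_t(y) w(eta) on |eta| <= 2. *)
Lemma near_shell_cvg (t : R) : 0 < t ->
  (\int[lebesgue_spacetime d]_(p in unit_shell `&` resonant)
     (rescaled_density t n p)%:E)%E @[n --> \oo] -->
  ((\int[mu]_x (fejer t x)%:E) * shell_constant)%E.
Proof.
move=> t0.
under eq_fun do rewrite near_shellE.
pose w2 v := 4 * (\1_[set v : vecR R d | enorm v <= 2] v * space_weight H v).
have mw2 : measurable_fun setT w2.
  apply: measurable_funM => //.
  apply: measurable_funM; last exact: measurable_space_weight.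
  by apply: measurable_indic; exact: measurable_ball_enorm.
have w20 v : 0 <= w2 v by rewrite !mulr_ge0// space_weight_ge0.
have -> : ((\int[mu]_x (fejer t x)%:E) * shell_constant)%E =
    (\int[lebesgue_spacetime d]_p (fejer t p.1 * shell_weight p.2)%:E)%E.
  rewrite /lebesgue_spacetime integral_prod_mul//.
  - exact: measurable_fejer.
  - exact: measurable_shell_weight.
  - by move=> x; exact: fejer_ge0.
  - exact: shell_weight_ge0.
have mfst (f : R -> R) : measurable_fun setT f ->
    measurable_fun setT (fun p : space => f p.1).
  by move=> mf; exact: measurableT_comp mf measurable_fst.
have msnd (f : vecR R d -> R) : measurable_fun setT f ->
    measurable_fun setT (fun p : space => f p.2).
  by move=> mf; exact: measurableT_comp mf measurable_snd.
have [] := @dominated_convergence _ _ _ (lebesgue_spacetime d) setT measurableT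
  (fun n p => (near_density t n p)%:E) (fun p => (fejer t p.1 * shell_weight p.2)%:E)
  (fun p => (fejer t p.1 * w2 p.2)%:E) => //.
- by move=> n; apply/measurable_EFinP; exact: measurable_near_density.
- apply/measurable_EFinP; apply: measurable_funM.
    by apply: mfst; exact: measurable_fejer.
  by apply: msnd; exact: measurable_shell_weight.
- pose S := [set v : vecR R d | enorm v = 1] `|` [set v | enorm v = 2].
  have mSr r : measurable [set v : vecR R d | enorm v = r].
    have := @measurable_enorm R d measurableT _ (measurable_set1 r).
    by rewrite setTI.
  have mS : measurable S by apply: measurableU.
  exists (setT `*` S); split.
  + exact: measurableX.
  + transitivity (mu setT * lebesgue_vec R d S)%E; first exact: product_measure1E.
    have -> : lebesgue_vec R d S = 0%E.
      by apply: null_set_setU => //; exact: lebesgue_sphere0.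
    by rewrite mule0.
  + move=> p /= hp; split => //; apply: contrapT => /= Sp; apply: hp => _.
    apply: cvg_EFin; first exact: nearW.
    apply: near_density_cvg; apply/eqP => e; apply: Sp; [by left|by right].
- apply/integrableP; split.
    apply/measurable_EFinP; apply: measurable_funM; last exact: msnd.
    by apply: mfst; exact: measurable_fejer.
  have fw0 p : 0 <= fejer t p.1 * w2 p.2 by apply: mulr_ge0 => //; exact: fejer_ge0.
  under eq_integral do rewrite gee0_abs ?lee_fin ?fw0//.
  rewrite /lebesgue_spacetime integral_prod_mul//; last 2 first.
  - exact: measurable_fejer.
  - by move=> x; exact: fejer_ge0.
  have If0 : (0 <= \int[mu]_x (fejer t x)%:E)%E.
    by apply: integral_ge0 => x _; rewrite lee_fin fejer_ge0.
  apply: lte_mul_pinfty => //.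
    by rewrite ge0_fin_numE//; exact: integral_fejer_lty.
  under eq_integral do rewrite EFinM.
  rewrite ge0_integralZl_EFin//; last 2 first.
  - by move=> v _; rewrite lee_fin mulr_ge0// space_weight_ge0.
  - apply/measurable_EFinP; apply: measurable_funM; last exact: measurable_space_weight.
    by apply: measurable_indic; exact: measurable_ball_enorm.
  by apply: lte_mul_pinfty => //; exact: integral_space_weight_lty.
- apply/aeW => p n _; rewrite gee0_abs ?lee_fin ?near_density_ge0//.
  exact: near_density_le.
Qed.

Lemma shell_cvg (t : R) : 0 < t ->
  (\int[lebesgue_spacetime d]_(p in unit_shell)
     (rescaled_density t n p)%:E)%E @[n --> \oo] -->
  ((\int[mu]_x (fejer t x)%:E) * shell_constant)%E.
Proof.
move=> t0; rewrite -[X in _ --> X]adde0.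
have mI := measurableI _ _ measurable_unit_shell measurable_resonant.
have mD := measurableD measurable_unit_shell measurable_resonant.
under eq_fun => n.
  rewrite -(setUIDK unit_shell resonant) ge0_integral_setU//; last 3 first.
  - apply: measurable_funTS; apply/measurable_EFinP; exact: measurable_rescaled_density.
  - by move=> p _; rewrite lee_fin rescaled_density_ge0.
  - by rewrite disj_set2E; apply/eqP; apply/seteqP; split => // p [[_ ?] [_]].
  over.
apply: cvgeD; [|exact: near_shell_cvg|exact: far_shell_cvg].
by rewrite fin_num_adde_defl.
Qed.

End shell.

(** * Growth of the energy *)

Section recurrences.
Context {R : realType}.

(** Once e n <= (1 - a) eps / 2, the excess of |z n| over eps / 2 is multiplied
    by at most a at each step. *)
Lemma contraction_cvg0 (a : R) (z e : R^nat) : 0 <= a < 1 ->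
  (forall n, `|z n.+1| <= a * `|z n| + e n) -> e n @[n --> \oo] --> 0 ->
  z n @[n --> \oo] --> 0.
Proof.
move=> /andP[a0 a1] ze e0; apply/cvgr0Pnorm_le => eps eps0.
have b0 : 0 < (1 - a) * (eps / 2) by rewrite mulr_gt0 ?divr_gt0 ?subr_gt0.
have [N _ HN] : \forall n \near \oo, e n <= (1 - a) * (eps / 2).
  exact: (cvgr_le _ e0).
have zN k : `|z (k + N)%N| <= a ^+ k * `|z N| + eps / 2.
  elim: k => [|k IH]; first by rewrite add0n expr0 mul1r lerDl ltW ?divr_gt0.
  apply: (le_trans (ze _)); have := HN (k + N)%N (leq_addl _ _); rewrite exprS /= => ek.
  have := ler_wpM2l a0 IH; lra.
have ak : `|z N| * a ^+ k @[k --> \oo] --> 0.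
  by apply: cvg_geometric; rewrite ger0_norm.
have [K _ HK] : \forall k \near \oo, `|z N| * a ^+ k <= eps / 2.
  by apply: (cvgr_le _ ak); rewrite divr_gt0.
exists (K + N)%N => // n /= Kn; rewrite -(subnK (leq_trans (leq_addl K N) Kn)).
apply: (le_trans (zN _)); have := HK (n - N)%N.
rewrite /= leq_subRL ?(leq_trans (leq_addl K N) Kn)//.
by rewrite addnC => /(_ Kn); rewrite mulrC; lra.
Qed.

(** The deviation of x n / q^n from l / (q - 1) is contracted by 1 / q at each
    step, up to the error (u n - l) / q. *)
Lemma cvg_geometric_recurrence (q l : R) (x u : R^nat) : 1 < q ->
  (forall n, x n.+1 = x n + q ^+ n * u n) -> u n @[n --> \oo] --> l ->
  x n / q ^+ n @[n --> \oo] --> l / (q - 1).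
Proof.
move=> q1 xS ul; have q0 : 0 < q by rewrite (lt_trans _ q1).
have qn n : q ^+ n != 0 by rewrite expf_neq0// gt_eqF.
have q10 : q - 1 != 0 by rewrite gt_eqF// subr_gt0.
apply/subr_cvg0.
apply: (@contraction_cvg0 q^-1 _ (fun n => `|u n - l| / q)).
- by rewrite invr_ge0 (ltW q0) invf_lt1.
- move=> n; rewrite xS.
  have -> : (x n + q ^+ n * u n) / q ^+ n.+1 - l / (q - 1) =
      q^-1 * (x n / q ^+ n - l / (q - 1)) + (u n - l) / q.
    by rewrite exprS; field; rewrite q10 qn gt_eqF.
  by rewrite (le_trans (ler_normD _ _))// !normrM normfV (gtr0_norm q0).
- rewrite -[X in _ --> X](mul0r q^-1); apply: cvgM; last exact: cvg_cst.
  by apply/norm_cvg0P; apply/subr_cvg0.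
Qed.

Lemma cvg_arithmetic_recurrence (l : R) (x u : R^nat) :
  (forall n, x n.+1 = x n + u n) -> u n @[n --> \oo] --> l ->
  x n / n%:R @[n --> \oo] --> l.
Proof.
move=> xS ul; rewrite -(cvg_shiftS (fun n => x n / n%:R)).
have xE n : x n = x 0%N + series u n.
  elim: n => [|n IH]; first by rewrite /series/= big_geq// addr0.
  by rewrite xS IH seriesSr addrA.
rewrite (_ : (fun n => _) =
    (fun n => x 0%N * n.+1%:R^-1 + arithmetic_mean u n)); last first.
  by apply/funext => n; rewrite xE mulrDl /arithmetic_mean /= [X in _ + X]mulrC.
rewrite -[l]add0r; apply: (@cvgD _ R^o); last exact: cesaro.
rewrite -[X in _ --> X](mulr0 (x 0%N)); apply: cvgM; first exact: cvg_cst.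
exact: cvg_harmonic.
Qed.

End recurrences.

Section energy.
Context {R : realType} (d : nat) (H : 'I_d.+1 -> R).
Context (hH : forall i, 0 < H i < 1).
Local Notation mu := (@lebesgue_measure R).
Local Notation space := (measurableTypeR R * vecR R d)%type.
Implicit Types (p : space) (v : vecR R d).

Lemma shell_constant_lty : (shell_constant H < +oo)%E.
Proof.
apply: (@le_lt_trans _ _ (\int[lebesgue_vec R d]_v
   (4%:E * (\1_[set v : vecR R d | (enorm v <= 2)%R] v * space_weight H v)%:E))%E).
  apply: ge0_le_integral => //.
  - by move=> v _; rewrite lee_fin shell_weight_ge0.
  - by apply/measurable_EFinP; exact: measurable_shell_weight.
  - apply: measurable_funeM; apply/measurable_EFinP; apply: measurable_funM.
      by apply: measurable_indic; exact: measurable_ball_enorm.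
    exact: measurable_space_weight.
  - move=> v _; rewrite -EFinM lee_fin /shell_weight.
    have [/andP[v1 v2]|h] := pselect (1 < enorm v <= 2); last first.
      by rewrite indicE memNset// mul0r !mulr_ge0// space_weight_ge0.
    have -> : \1_[set v : vecR R d | 1 < enorm v <= 2] v = 1 :> R.
      by rewrite indicE mem_set//=; apply/andP.
    have -> : \1_[set v : vecR R d | enorm v <= 2] v = 1 :> R.
      by rewrite indicE mem_set.
    rewrite !mul1r mulrC ler_wpM2r ?space_weight_ge0//.
    apply: invr_powR_le4; first by have /andP[] := hH ord0; lra.
    have v21 : 1 < enorm v ^+ 2 by rewrite exprn_egt1.
    have v0 : 0 <= enorm v by exact: enorm_ge0.
    by apply/andP; split; nra.
rewrite ge0_integralZl_EFin//; last 2 first.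
- by move=> v _; rewrite lee_fin mulr_ge0// space_weight_ge0.
- apply/measurable_EFinP; apply: measurable_funM.
    by apply: measurable_indic; exact: measurable_ball_enorm.
  exact: measurable_space_weight.
by apply: lte_mul_pinfty => //; exact: integral_space_weight_lty.
Qed.

(** The cube of the points with all coordinates in ]1/s, 2/s[, s = sqrt d, lies
    in the annulus and avoids the coordinate hyperplanes, so the integrand is
    positive on it. *)
Lemma shell_constant_gt0 : (0 < d)%N -> (0 < shell_constant H)%E.
Proof.
move=> d0; pose s : R := Num.sqrt d%:R.
have s0 : 0 < s by rewrite sqrtr_gt0 ltr0n.
have s2 : s ^+ 2 = d%:R by rewrite sqr_sqrtr.
pose I : set R := `]s^-1, 2 / s[%classic.
pose Q : set (vecR R d) := [set v | forall i, I (tnth v i)].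
have mI : measurable I by exact: measurable_itv.
have mQ : measurable Q.
  rewrite [X in measurable X](_ : _ =
    \bigcap_(i in [set: 'I_d]) ((@tnth d _ ^~ i) @^-1` I)).
    apply: fin_bigcap_measurable => // i _.
    rewrite -[X in measurable X]setTI; exact: measurable_tnth.
  by apply/seteqP; split => v /= Av i; [move=> _|]; exact: Av.
have mw := @measurable_shell_weight R d H.
apply: (@lt_le_trans _ _
    (\int[lebesgue_vec R d]_(v in Q) (shell_weight H v)%:E)%E); last first.
  apply: ge0_subset_integral => //; first exact/measurable_EFinP.
  by move=> v _; rewrite lee_fin shell_weight_ge0.
apply: integral_gt0 => //.
- by apply: measurable_funTS; apply/measurable_EFinP.
- move=> v Qv; rewrite lte_fin /shell_weight.
  have sV0 : 0 < s^-1 by rewrite invr_gt0.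
  have vi0 i : 0 < tnth v i.
    by have := Qv i; rewrite /I/= in_itv/= => /andP[+ _]; apply: lt_trans.
  have e1 : 1 < enorm v ^+ 2 < 4.
    rewrite sqr_enorm.
    have c1 : \sum_(i < d) s^-1 ^+ 2 = 1 :> R.
      by rewrite sumr_const card_ord -mulr_natr exprVn s2 mulVf// pnatr_eq0 -lt0n.
    have c4 : \sum_(i < d) (2 / s) ^+ 2 = 4 :> R.
      under eq_bigr do rewrite exprMn.
      by rewrite -mulr_sumr c1 mulr1 -natrX.
    apply/andP; split.
    - rewrite -[ltLHS]c1; apply: ltr_sum.
        by apply/hasP; exists (Ordinal d0) => //; exact: mem_index_enum.
      move=> i _; have := Qv i; rewrite /I/= in_itv/= -expr2 => /andP[h _].
      by apply: ltrXn2r => //; exact: ltW.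
    - rewrite -[ltRHS]c4; apply: ltr_sum.
        by apply/hasP; exists (Ordinal d0) => //; exact: mem_index_enum.
      move=> i _; have := Qv i; rewrite /I/= in_itv/= -expr2 => /andP[_ h].
      by apply: ltrXn2r => //; exact: ltW.
  move/andP : e1 => [e1 e4].
  have en0 := @enorm_ge0 R d v.
  rewrite indicE mem_set/= ?mul1r; last by apply/andP; split; nra.
  rewrite mulr_gt0 ?invr_gt0 ?powR_gt0 ?(lt_trans _ e1)//.
  by apply: prodr_gt0 => i _; rewrite invr_gt0 powR_gt0// normr_gt0 gt_eqF.
- have QE : (lebesgue_vec R d Q = \prod_(i < d) mu I)%E.
    exact: (@lebesgue_vec_box R d (fun=> I)).
  suff : (0 < \prod_(i < d) mu I)%E by rewrite -QE; exact.
  rewrite (_ : mu I = (s^-1)%:E); last first.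
    rewrite /I /= lebesgue_measure_itv/= lte_fin ifT.
      by rewrite -EFinB; congr EFin; field; rewrite gt_eqF.
    by rewrite -[ltLHS]mul1r ltr_pM2r ?invr_gt0// ltr1n.
  by rewrite prodEFin lte_fin; apply: prodr_gt0 => i _; rewrite invr_gt0.
Qed.

(** The second moment at level n and time t, up to the factor c^2. *)
Definition energy (t : R) (n : nat) : \bar R :=
  (\int[lebesgue_spacetime d]_(p in freq_domain n)
     (spectral_density H p * fejer t (offset p))%:E)%E.

(** q = 4^beta, the factor by which the shell contributions grow. *)
Definition growth : R := 2 `^ (2 * (d.+1%:R - hurst_sum H)).

Lemma growth_gt1 : 0 < d.+1%:R - hurst_sum H -> 1 < growth.
Proof.
move=> b0; rewrite /growth.
rewrite -[ltLHS](congr1 (fun h => h (2 * (d.+1%:R - hurst_sum H))) (@powR1 R)).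
by apply: gt0_ltr_powR; rewrite ?nnegrE ?mulr_gt0 ?ltr1n.
Qed.

Lemma density_fejer_ge0 t p : 0 <= spectral_density H p * fejer t (offset p).
Proof.
by apply: mulr_ge0; [exact: spectral_density_ge0|exact: fejer_ge0].
Qed.

Lemma measurable_density_fejer t :
  measurable_fun setT (fun p : space => spectral_density H p * fejer t (offset p)).
Proof.
apply: measurable_funM; first exact: measurable_spectral_density.
exact: measurableT_comp (measurable_fejer t) (@measurable_offset R d).
Qed.

Lemma energy_ge0 t n : (0 <= energy t n)%E.
Proof. by apply: integral_ge0 => p _; rewrite lee_fin density_fejer_ge0. Qed.

Lemma energy_lty t n : 0 < t -> (energy t n < +oo)%E.
Proof.
move=> t0; apply: (@le_lt_trans _ _ (\int[lebesgue_spacetime d]_(p in freq_domain n)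
    ((2 * t ^+ 2)%:E * (spectral_density H p)%:E))%E).
  have mD := @measurable_freq_domain R d n.
  apply: ge0_le_integral => //.
  - by move=> p _; rewrite lee_fin density_fejer_ge0.
  - by apply: measurable_funTS; apply/measurable_EFinP; exact: measurable_density_fejer.
  - apply: measurable_funTS; apply: measurable_funeM; apply/measurable_EFinP.
    exact: measurable_spectral_density.
  - move=> p _; rewrite -EFinM lee_fin mulrC.
    by rewrite ler_wpM2r ?fejer_bound// spectral_density_ge0.
have t20 : 0 <= 2 * t ^+ 2 by rewrite mulr_ge0// sqr_ge0.
rewrite ge0_integralZl_EFin//; last 3 first.
- exact: measurable_freq_domain.
- by move=> p _; rewrite lee_fin spectral_density_ge0.
- apply: measurable_funTS; apply/measurable_EFinP.
  exact: measurable_spectral_density.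
apply: lte_mul_pinfty => //.
by apply: integral_spectral_density_lty; rewrite ?exprn_gt0.
Qed.

Lemma freq_domain_scale m n p :
  freq_domain (m + n) (((2 ^+ n) ^+ 2 * p.1)%R, scalev (2 ^+ n) p.2) <->
  freq_domain m p.
Proof.
have n0 : 0 < 2 ^+ n :> R by rewrite exprn_gt0.
have n20 : 0 < (2 ^+ n) ^+ 2 :> R by rewrite exprn_gt0.
rewrite /freq_domain/= normrM (gtr0_norm n20) (enorm_scalev _ (ltW n0)).
rewrite addnC exprD (ler_pM2l n0) mulnDr exprD.
have -> : 2 ^+ (2 * n) = (2 ^+ n) ^+ 2 :> R by rewrite mulnC exprM.
by rewrite (ler_pM2l n20).
Qed.

(** D_(n+1) \ D_n is the dilate of the fixed shell by the factors 4^n and 2^n. *)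
Lemma energyS t n : (energy t n.+1 = energy t n +
  (growth ^+ n)%:E *
  \int[lebesgue_spacetime d]_(p in @unit_shell R d) (rescaled_density H t n p)%:E)%E.
Proof.
have mD k := @measurable_freq_domain R d k.
have sD : freq_domain n `<=` @freq_domain R d n.+1.
  move=> p [p1 p2]; split.
    by rewrite (le_trans p1)// ler_eXn2l ?ltr1n// leq_mul2l/=.
  by rewrite (le_trans p2)// ler_eXn2l ?ltr1n.
have mF := measurable_density_fejer t.
have r0 : 0 < 2 ^+ n :> R by rewrite exprn_gt0.
rewrite {1}/energy -(setDUK sD) ge0_integral_setU//; last 4 first.
- exact: measurableD.
- by apply: measurable_funTS; apply/measurable_EFinP.
- by move=> p _; rewrite lee_fin density_fejer_ge0.
- by rewrite disj_set2E setDIK.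
congr (_ + _)%E.
have mDD : measurable (freq_domain n.+1 `\` @freq_domain R d n) by exact: measurableD.
have mG : measurable_fun setT (fun p : space =>
    (\1_(freq_domain n.+1 `\` @freq_domain R d n) p *
     (spectral_density H p * fejer t (offset p)))%:E).
  by apply/measurable_EFinP; apply: measurable_funM => //; exact: measurable_indic.
have md : measurable_fun setT (fun p : space =>
    (((2 ^+ n) ^+ 2 * p.1 : R), scalev (2 ^+ n) p.2) : space).
  apply/measurable_fun_pairP; split => /=.
    by apply: measurable_funM => //; exact: measurable_fst.
  exact: measurableT_comp (@measurable_scalev R d (2 ^+ n)) measurable_snd.
rewrite integral_indicE (integral_parabolic_scaling r0); last 2 first.
- exact: mG.
- by move=> p; rewrite lee_fin mulr_ge0// density_fejer_ge0.
rewrite [in RHS]integral_indicE -!ge0_integralZl_EFin//; last 5 first.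
- by move=> p _; rewrite lee_fin mulr_ge0// rescaled_density_ge0.
- apply/measurable_EFinP; apply: measurable_funM.
    by apply: measurable_indic; exact: measurable_unit_shell.
  exact: measurable_rescaled_density.
- by rewrite exprn_ge0// powR_ge0.
- by move=> p _; rewrite lee_fin mulr_ge0// density_fejer_ge0.
- exact: measurableT_comp mG md.
have e4 : (2 ^+ n) ^+ 2 = 4 ^+ n :> R by rewrite exprAC -natrX.
apply: eq_integral => p _; rewrite -!EFinM; congr EFin.
set dp := (_, scalev _ _).
have -> : \1_(freq_domain n.+1 `\` freq_domain n) dp = \1_(@unit_shell R d) p :> R.
  rewrite !indicE; congr (_%:R); congr nat_of_bool; apply/idP/idP => /set_mem [h1 h2].
  - apply/mem_set; split; first exact/(freq_domain_scale 1 n).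
    by move=> h; apply: h2; exact/(freq_domain_scale 0 n).
  - apply/mem_set; split; first exact/(freq_domain_scale 1 n).
    by move=> h; apply: h2; exact/(freq_domain_scale 0 n).
have -> : offset dp = 4 ^+ n * offset p.
  rewrite /offset/= (enorm_scalev _ (ltW r0)) exprMn mulrBr.
  by rewrite e4.
rewrite mulrCA [RHS]mulrCA; congr (_ * _).
rewrite /rescaled_density.
rewrite -e4.
have := spectral_density_scale H p r0; rewrite -/dp.
have -> : (2 ^+ n) `^ (2 * (d.+1%:R - hurst_sum H)) = growth ^+ n :> R.
  by rewrite /growth -powR_mulrn ?powR_ge0// -powRrM -(powR_mulrn n)// -powRrM mulrC.
have regroup (A B D G S F : R) : B * D = G * S -> A * B * (D * F) = G * (A * (S * F)).
  by move=> e; rewrite (_ : _ * (D * F) = A * (B * D) * F); [rewrite e|]; ring.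
exact: regroup.
Qed.

Lemma energy_recurrence t n : 0 < t -> fine (energy t n.+1) = fine (energy t n) +
  growth ^+ n * fine (\int[lebesgue_spacetime d]_(p in @unit_shell R d)
    (rescaled_density H t n p)%:E)%E.
Proof.
move=> t0; have g0 : 0 < growth ^+ n by rewrite exprn_gt0// powR_gt0.
have En : energy t n \is a fin_num.
  by rewrite ge0_fin_numE ?energy_lty// energy_ge0.
have ES : energy t n.+1 \is a fin_num.
  by rewrite ge0_fin_numE ?energy_lty// energy_ge0.
set I := (\int[_]_(p in _) _)%E.
have I0 : (0 <= I)%E.
  by apply: integral_ge0 => p _; rewrite lee_fin rescaled_density_ge0.
have If : I \is a fin_num.
  rewrite ge0_fin_numE// ltNge leye_eq; apply/negP => /eqP Iy.
  by move: ES; rewrite energyS -/I Iy gt0_muley ?lte_fin// -(fineK En).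
by rewrite energyS -/I fineD ?fineM// fin_numM.
Qed.

Lemma energy_asymptotics (t : R) : 0 < t -> 0 <= d.+1%:R - hurst_sum H ->
  let L := t * fine (\int[mu]_x (fejer 1 x)%:E) * fine (shell_constant H) in
  (d.+1%:R - hurst_sum H = 0 ->
     fine (energy t n) / n%:R @[n --> \oo] --> L) /\
  (0 < d.+1%:R - hurst_sum H ->
     fine (energy t n) / growth ^+ n @[n --> \oo] --> L / (growth - 1)).
Proof.
move=> t0 b0 L.
have cL : fine (\int[lebesgue_spacetime d]_(p in @unit_shell R d)
    (rescaled_density H t n p)%:E)%E @[n --> \oo] --> L.
  have kf : (\int[mu]_x (fejer 1 x)%:E)%E \is a fin_num.
    by rewrite ge0_fin_numE ?integral_fejer_lty// ltW// integral_fejer_gt0.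
  have Jf : shell_constant H \is a fin_num.
    rewrite ge0_fin_numE ?shell_constant_lty//.
    by apply: integral_ge0 => v _; rewrite lee_fin shell_weight_ge0.
  apply: fine_cvg.
  rewrite /L EFinM EFinM (fineK kf) (fineK Jf) -integral_fejer_scale//.
  exact: shell_cvg.
split => [b|b].
- apply: cvg_arithmetic_recurrence cL => n.
  by rewrite energy_recurrence// /growth b mulr0 powRr0 expr1n mul1r.
- apply: cvg_geometric_recurrence cL => [|n]; last exact: energy_recurrence.
  exact: growth_gt1.
Qed.

End energy.

(** * Second moments of the solution *)

Section complex_identities.
Local Open Scope complex_scope.
Context {R : realType}.

Lemma sqr_normc (z : R[i]) :
  ComplexField.Normc.normc z ^+ 2 = complex.Re z ^+ 2 + complex.Im z ^+ 2.
Proof. by case: z => a b /=; rewrite sqr_sqrtr// addr_ge0 ?sqr_ge0. Qed.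

Lemma mulc_conj (z : R[i]) : z * z^* = (ComplexField.Normc.normc z ^+ 2)%:C.
Proof.
rewrite sqr_normc; case: z => a b; apply/eqP; rewrite eq_complex /=.
by apply/andP; split; apply/eqP; ring.
Qed.

Lemma sqr_normcM (z w : R[i]) :
  ComplexField.Normc.normc (z * w) ^+ 2 =
  ComplexField.Normc.normc z ^+ 2 * ComplexField.Normc.normc w ^+ 2.
Proof. by rewrite ComplexField.Normc.normcM exprMn. Qed.

Lemma sqr_normc_expi (a : R) : ComplexField.Normc.normc (expi a) ^+ 2 = 1.
Proof. by rewrite sqr_normc /expi /= cos2Dsin2. Qed.

Lemma sqr_normc_gamma (t xi r : R) : 0 < t ->
  ComplexField.Normc.normc (gamma t xi r) ^+ 2 = fejer t (r ^+ 2 - xi).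
Proof.
move=> t0; rewrite /gamma sqr_normcM sqr_normc_expi mul1r sqr_normc /=.
exact: Rintegral_cos_sin.
Qed.

End complex_identities.

Section covariance_diagonal.
Local Open Scope complex_scope.

Lemma linear_cov_diag (R : realType) d (H : 'I_d.+1 -> R) (c : R) n t x : 0 < t ->
  complex.Re (linear_cov H c n n t t x x) = c ^+ 2 * fine (energy H t n).
Proof.
move=> t0.
have integrandE (p : measurableTypeR R * vecR R d) :
    (spectral_density H p)%:C * gamma t p.1 (enorm p.2) *
      (gamma t p.1 (enorm p.2))^* * expi (dotv p.2 (subv x x)) =
    (spectral_density H p * fejer t (offset p))%:C.
  have -> : dotv p.2 (subv x x) = 0.
    by rewrite /dotv big1// => i _; rewrite tnth_mktuple subrr mulr0.
  have -> : expi (0 : R) = 1 by rewrite /expi cos0 sin0.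
  by rewrite mulr1 -mulrA mulc_conj sqr_normc_gamma// -rmorphM.
rewrite /linear_cov setIid (_ : (fun p => _) =
  (fun p => (spectral_density H p * fejer t (offset p))%:C)); last first.
  by apply/funext => p; exact: integrandE.
by rewrite /cintegral /= mul0r subr0.
Qed.

End covariance_diagonal.

Section gaussian_second_moment.
Local Open Scope complex_scope.
Context {R : realType}.
Local Notation mu := (@lebesgue_measure R).

(** Half of the Gaussian exponent absorbs x^2: the integrand is at most a
    constant times the normal density of variance 2 s^2. *)
Lemma integral_sqr_normal_lty (s : R) : 0 < s ->
  (\int[normal_prob 0 s]_x (x ^+ 2)%:E < +oo)%E.
Proof.
move=> s0; have sn0 : s != 0 by rewrite gt_eqF.
have dom := normal_prob_dominates 0 s.
have msq : measurable_fun [set: R] (fun x : R => (x ^+ 2)%:E).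
  by apply/measurable_EFinP; exact: exprn_measurable.
have mpdf : measurable_fun [set: R] (fun x : R => (normal_pdf 0 s x)%:E).
  by apply/measurable_EFinP; exact: measurable_normal_pdf.
rewrite -(@Radon_Nikodym_SigmaFinite.change_of_variables _ _ _
    (normal_prob 0 s) mu dom)//; last first.
  by move=> x; rewrite lee_fin sqr_ge0.
(* The abstract Radon-Nikodym derivative is the normal density. *)
have -> : (\int[mu]_x
      ((x ^+ 2)%:E * Radon_Nikodym_SigmaFinite.f (normal_prob 0 s) mu x) =
    \int[mu]_x ((x ^+ 2)%:E * (normal_pdf 0 s x)%:E))%E.
  apply: ae_eq_integral => //.
  - apply: emeasurable_funM => //.
    exact: measurable_int (Radon_Nikodym_SigmaFinite.f_integrable _).
  - exact: emeasurable_funM.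
  - apply: ae_eqe_mul2l; apply: integral_ae_eq => //.
    + exact: Radon_Nikodym_SigmaFinite.f_integrable.
    + by move=> A _ mA; rewrite -Radon_Nikodym_SigmaFinite.f_integral.
(* y exp (- 2 y) <= exp (- y) with y = x^2 / (4 s^2). *)
pose s' := s * Num.sqrt 2.
have s'0 : s' != 0 by rewrite mulf_neq0// sqrtr_eq0 -ltNge.
have s'2 : s' ^+ 2 = s ^+ 2 * 2 by rewrite exprMn sqr_sqrtr.
pose C := 4 * s ^+ 2 * normal_peak s / normal_peak s'.
have p0 := normal_peak_gt0 sn0; have p'0 := normal_peak_gt0 s'0.
have C0 : 0 <= C by rewrite divr_ge0 ?mulr_ge0 ?sqr_ge0// ltW.
apply: (@le_lt_trans _ _ (\int[mu]_x (C%:E * (normal_pdf 0 s' x)%:E))%E).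
  apply: ge0_le_integral => //.
  - by move=> x _; rewrite -EFinM lee_fin mulr_ge0 ?sqr_ge0 ?normal_pdf_ge0.
  - exact: emeasurable_funM.
  - by apply: measurable_funeM; apply/measurable_EFinP; exact: measurable_normal_pdf.
  - move=> x _; rewrite -!EFinM lee_fin !normal_pdfE// /normal_fun subr0 s'2.
    set y := x ^+ 2 / (4 * s ^+ 2).
    have -> : - x ^+ 2 / (s ^+ 2 *+ 2) = - y - y.
      by rewrite /y; field; rewrite gt_eqF.
    have -> : - x ^+ 2 / ((s ^+ 2 * 2) *+ 2) = - y.
      by rewrite /y; field; rewrite gt_eqF.
    have -> : x ^+ 2 = 4 * s ^+ 2 * y by rewrite /y; field; rewrite gt_eqF.
    have -> : C * (normal_peak s' * expR (- y)) =
        4 * s ^+ 2 * normal_peak s * expR (- y).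
      by rewrite /C; field; rewrite gt_eqF.
    have y0 : 0 <= y.
      by apply: divr_ge0; [|apply: mulr_ge0 => //]; exact: sqr_ge0.
    have ye : y * expR (- y) <= 1.
      rewrite expRN ler_pdivrMr ?expR_gt0// mul1r.
      by apply: le_trans (expR_ge1Dx _); rewrite lerDr.
    rewrite expRD.
    have -> : 4 * s ^+ 2 * y * (normal_peak s * (expR (- y) * expR (- y))) =
      4 * s ^+ 2 * normal_peak s * expR (- y) * (y * expR (- y)) by ring.
    by rewrite ler_piMr// !mulr_ge0 ?expR_ge0// ltW.
rewrite ge0_integralZl_EFin//; last 2 first.
- by move=> x _; rewrite lee_fin normal_pdf_ge0.
- by apply/measurable_EFinP; exact: measurable_normal_pdf.
by rewrite integral_normal_pdf mule1 ltry.
Qed.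

(** The law of Y is a Dirac mass when s = 0, and is normal otherwise. *)
Lemma centered_normal_sqr_lty d (T : measurableType d) (P : probability T R)
    (Y : T -> R) : centered_normal P Y ->
  (\int[P]_w (Y w ^+ 2)%:E < +oo)%E.
Proof.
move=> [mY [s [s0 PY]]].
have msq : measurable_fun [set: measurableTypeR R]
    (fun x : measurableTypeR R => ((x : R) ^+ 2)%:E).
  by apply/measurable_EFinP; exact: exprn_measurable.
have mY' : measurable_fun setT (Y : T -> measurableTypeR R) by exact: mY.
rewrite (_ : (\int[P]_w (Y w ^+ 2)%:E =
    \int[pushforward P (Y : T -> measurableTypeR R)]_x (x ^+ 2)%:E)%E); last first.
  rewrite ge0_integral_pushforward// => x _.
  by rewrite lee_fin sqr_ge0.
have [se|sn] := eqVneq s 0.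
  rewrite (@eq_measure_integral _ _ _ setT (\d_ (0 : measurableTypeR R))); last first.
    by move=> A mA _; rewrite [LHS]PY// se eqxx.
  rewrite integral_dirac// diracT mul1e expr0n /=; exact: ltry.
rewrite (@eq_measure_integral _ _ _ setT (normal_prob 0 s)); last first.
  by move=> A mA _; rewrite [LHS]PY// (negbTE sn).
by apply: integral_sqr_normal_lty; rewrite lt_neqAle eq_sym sn.
Qed.

(** The real and imaginary parts of X i are particular linear combinations of
    the family, hence centered normal. *)
Lemma gaussian_second_moment_fin_num d (T : measurableType d) (P : probability T R)
    (I : Type) (D : set I) (X : I -> T -> R[i]) i :
  centered_complex_gaussian_process P D X -> D i ->
  second_moment P (X i) \is a fin_num.
Proof.
move=> GX Di.
have GRe : centered_normal P (fun w => complex.Re (X i w)).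
  have := GX 1%N (fun=> i) (fun=> 1) (fun=> 0) (fun=> Di).
  by under eq_fun do rewrite big_ord1 mul1r mul0r addr0.
have GIm : centered_normal P (fun w => complex.Im (X i w)).
  have := GX 1%N (fun=> i) (fun=> 0) (fun=> 1) (fun=> Di).
  by under eq_fun do rewrite big_ord1 mul1r mul0r add0r.
have msq (Y : T -> R) : centered_normal P Y ->
    measurable_fun setT (fun w => (Y w ^+ 2)%:E).
  by move=> [mY _]; apply/measurable_EFinP; exact: measurable_funX.
rewrite /second_moment unlock ge0_fin_numE; last first.
  by apply: integral_ge0 => w _; rewrite lee_fin sqr_ge0.
under eq_integral do rewrite sqr_normc EFinD.
rewrite ge0_integralD//.
- by rewrite lte_add_pinfty// centered_normal_sqr_lty.
- by move=> w _; rewrite lee_fin sqr_ge0.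
- exact: msq.
- by move=> w _; rewrite lee_fin sqr_ge0.
- exact: msq.
Qed.

End gaussian_second_moment.

Section linear_solution.
Local Open Scope complex_scope.
Context {R : realType} (d : nat) (H : 'I_d.+1 -> R) dO (Omega : measurableType dO)
  (P : probability Omega R) (c : R) (Psi : nat -> R -> vecR R d -> Omega -> R[i]).
Context (sol : linear_solution H P c Psi).

(** The product of a complex number with its conjugate is real, so the real part
    of the covariance carries all the information. *)
Lemma fine_second_moment n t x : (1 <= n)%N -> 0 <= t ->
  fine (second_moment P (Psi n t x)) = complex.Re (linear_cov H c n n t t x x).
Proof.
move=> n1 t0; case: sol => _ cov _; rewrite -cov// /cexpectation /=.
by congr (fine (expectation _ _)); apply/funext => w; rewrite mulc_conj.
Qed.

Lemma second_moment_stationary n t x y : (1 <= n)%N -> 0 <= t ->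
  second_moment P (Psi n t x) = second_moment P (Psi n t y).
Proof.
move=> n1 t0; case: (sol) => G _ _.
have fin z : second_moment P (Psi n t z) \is a fin_num.
  exact: (gaussian_second_moment_fin_num (i := (n, t, z)) G).
rewrite -(fineK (fin x)) -(fineK (fin y)) !fine_second_moment//.
rewrite /linear_cov (_ : subv x x = subv y y)//.
by apply: eq_from_tnth => i; rewrite !tnth_mktuple !subrr.
Qed.

End linear_solution.

Theorem proposition1p5 (R : realType) (d : nat) (hd : (1 <= d)%N)
    (H : 'I_d.+1 -> R) (hH : forall i, 0 < H i < 1)
    (hsum : hurst_sum H <= d.+1%:R)
    (cH : R) (hcH : fbm_constant H cH) :
  exists c1 c2 : R, [/\ 0 < c1, 0 < c2 &
    forall (T : R) (dO : measure_display) (Omega : measurableType dO)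
      (P : probability Omega R) (Psi : nat -> R -> vecR R d -> Omega -> R[i]),
    0 < T -> linear_solution H P cH Psi ->
    (forall (n : nat) (t : R) (x y : vecR R d), (1 <= n)%N -> 0 <= t ->
      second_moment P (Psi n t x) = second_moment P (Psi n t y)) /\
    (forall (t : R) (x : vecR R d), 0 < t -> t <= T ->
      (hurst_sum H = d.+1%:R ->
        asymp_equiv (fun n : nat => fine (second_moment P (Psi n t x)))
                    (fun n : nat => c1 * t * n%:R)) /\
      (hurst_sum H < d.+1%:R ->
        asymp_equiv (fun n : nat => fine (second_moment P (Psi n t x)))
                    (fun n : nat =>
                       c2 * t * 2 `^ (2 * n%:R * (d.+1%:R - hurst_sum H)))))].
Proof.
have [cH0 _] := hcH.
pose k := fine (\int[lebesgue_measure]_x (fejer 1 x : R)%:E)%E.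
pose J := fine (shell_constant H).
have k0 : 0 < k by rewrite fine_gt0// integral_fejer_gt0 integral_fejer_lty.
have J0 : 0 < J by rewrite fine_gt0// shell_constant_gt0//= shell_constant_lty.
have c0 : 0 < cH ^+ 2 by rewrite exprn_gt0.
have b0 : 0 <= d.+1%:R - hurst_sum H by rewrite subr_ge0.
exists (cH ^+ 2 * k * J).
(* The denominator growth H - 1 vanishes in the critical case, hence the test. *)
exists (if growth H > 1 then cH ^+ 2 * k * J / (growth H - 1) else 1); split.
- by rewrite !mulr_gt0.
- by case: ifPn => // g1; rewrite !mulr_gt0// invr_gt0 subr_gt0.
move=> T dO Omega P Psi _ sol; split.
  by move=> n t x y; exact: (second_moment_stationary sol).
move=> t x t0 _.
have smE n : (1 <= n)%N ->
    fine (second_moment P (Psi n t x)) = cH ^+ 2 * fine (energy H t n).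
  by move=> n1; rewrite (fine_second_moment sol)// ?ltW// linear_cov_diag.
have [A1 A2] := energy_asymptotics hH t0 b0.
split => hs.
- have /A1 cv : d.+1%:R - hurst_sum H = 0 by rewrite hs subrr.
  have L0 : t * k * J != 0 by rewrite !mulf_neq0// gt_eqF.
  rewrite /asymp_equiv -[X in _ --> X](divff L0).
  apply: (@cvg_trans _ ((fine (energy H t n) / n%:R) / (t * k * J) @[n --> \oo])).
    apply: near_eq_cvg; near=> n.
    have n1 : (1 <= n)%N by near: n; exact: nbhs_infty_ge.
    rewrite smE//; have nn : n%:R != 0 :> R by rewrite pnatr_eq0 -lt0n.
    by field; rewrite nn !gt_eqF.
  by apply: cvgM; [exact: cv|exact: cvg_cst].
- have hb : 0 < d.+1%:R - hurst_sum H by rewrite subr_gt0.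
  have cv := A2 hb.
  have g1 := growth_gt1 hb.
  rewrite g1.
  have L0 : t * k * J / (growth H - 1) != 0.
    by rewrite !mulf_neq0 ?invr_neq0// gt_eqF// subr_gt0.
  rewrite /asymp_equiv -[X in _ --> X](divff L0).
  apply: (@cvg_trans _ ((fine (energy H t n) / growth H ^+ n) /
      (t * k * J / (growth H - 1)) @[n --> \oo])).
    apply: near_eq_cvg; near=> n.
    have n1 : (1 <= n)%N by near: n; exact: nbhs_infty_ge.
    rewrite smE//.
    have -> : 2 `^ (2 * n%:R * (d.+1%:R - hurst_sum H)) = growth H ^+ n.
      by rewrite /growth -powR_mulrn ?powR_ge0// -powRrM; congr (_ `^ _); ring.
    have gn : growth H ^+ n != 0 by rewrite expf_neq0// gt_eqF// (lt_trans _ g1).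
    have gg : growth H - 1 != 0 by rewrite gt_eqF// subr_gt0.
    by field; rewrite gn gg !gt_eqF.
  by apply: cvgM; [exact: cv|exact: cvg_cst].
Unshelve. all: by end_near. Qed.
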